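(* Let $T=(1,3,5^k,3,1)$ with $k\ge 4$. There are exactly $47$ potential Jordan degree types for pairs $(A,\ell)$ with $A\in\mathrm{Gor}(T)$ and $\ell\in A_1$; equivalently, there are exactly $47$ potential rank matrices for $T$.
   Context: $\mathsf{k}$ is an infinite field of arbitrary characteristic, $R=\mathsf{k}[x,y,z]$ with the standard grading; $5^k$ means $5$ repeated $k$ times. $\mathrm{Gor}(T)$ is the family of graded Artinian Gorenstein (AG) quotients $A=R/I$ with Hilbert function $T=(t_0,\dots,t_j)$; $j$ is the socle degree and $s=\max_i t_i$. For a nonzero linear form $\ell\in A_1$, the rank matrix $M_{A,\ell}$ is the $(j+1)\times(j+1)$ upper triangular matrix (indices $0,\dots,j$) with $(u,v)$ entry, $u\le v$, the rank of $\ell^{v-u}:A_u\to A_v$. A potential rank matrix for $T$ is an upper triangular $(j+1)\times(j+1)$ matrix $M$ of non-negative integers, with rows and columns indexed by $0,\dots,j$, satisfying the known necessary conditions for rank matrices: (i) writing $H(i)=(M_{0,i},M_{1,i+1},\dots,M_{j-i,j})$ for the $i$-th diagonal, $H(0)=T$, $H(1)\ne 0$, and each $H(i)$ is either zero or the Hilbert function of a graded AG quotient of $R$ of socle degree $j-i$; (ii) each difference $H(i)-(0,H(i+1))$ is an O-sequence, i.e. zero or the Hilbert function of a standard graded algebra; (iii) in the upper triangular part, rows are non-increasing from left to right and columns are non-decreasing from top to bottom; (iv) $M_{u+1,v}+M_{u,v+1}\ge M_{u,v}+M_{u+1,v+1}$ whenever $0\le u<v<j$; (v) for all $u\le v$ with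 $t_u=t_v=s$, the entry $M_{u,v}$ depends only on $v-u$. The potential Jordan degree type associated with $M$ is the multiset of pairs $(p,\nu)$ (strings of length $p$ starting in degree $\nu$) in which $(v-u+1,u)$ has multiplicity $M_{u,v}+M_{u-1,v+1}-M_{u-1,v}-M_{u,v+1}$ for $0\le u\le v\le j$ (entries with indices out of range being $0$). This correspondence between potential rank matrices and potential Jordan degree types is one-to-one; for $M=M_{A,\ell}$ it gives the actual Jordan degree type of $(A,\ell)$, i.e. the lengths and initial degrees of the strings in a decomposition of $A$ into graded cyclic $\mathsf{k}[\ell]$-modules. *)

(* Defs.v *)
From mathcomp Require Import all_boot all_order all_algebra.
From mathcomp.finmap Require Import finmap multiset.
From mathcomp.multinomials Require Import mpoly.

Set Implicit Arguments.
Unset Strict Implicit.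
Unset Printing Implicit Defensive.

Import GRing.Theory.

Local Open Scope mset_scope.
Local Open Scope nat_scope.

Definition infinite_type (K : eqType) : Prop :=
  forall s : seq K, exists x : K, x \notin s.

Definition has_exactly (X : eqType) (n : nat) (P : X -> Prop) : Prop :=
  exists s : seq X, [/\ uniq s, size s = n & forall x, x \in s <-> P x].

Section GradedQuotients.

Variables (K : fieldType) (n : nat).
Implicit Types (I : {mpoly K[n]} -> Prop) (p q a : {mpoly K[n]}).

Record homogeneous_ideal I : Prop := HomogeneousIdeal {
  hideal0 : I 0%R;
  hidealD : forall p q, I p -> I q -> I (p + q)%R;
  hidealM : forall a p, I p -> I (a * p)%R;
  hideal_homog : forall d p, I p -> I (pihomog mdeg d p)
}.

(* p represents an element of the socle (0 : m) of K[x_1..x_n]/I, where m is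
   the ideal generated by the variables. *)
Definition in_socle I p : Prop := forall i : 'I_n, I ('X_i * p)%R.

(* K[x_1..x_n]/I is a graded Artinian Gorenstein algebra of socle degree j. *)
Record graded_AG_ideal I (j : nat) : Prop := GradedAGIdeal {
  AG_homogeneous : homogeneous_ideal I;
  AG_top_nonzero : exists2 p, p \is j.-homog & ~ I p;
  AG_above_top : forall d p, j < d -> p \is d.-homog -> I p;
  AG_socle_dim1 : exists g, [/\ in_socle I g, ~ I g &
    forall p, in_socle I p -> exists c : K, I (p - c *: g)%R]
}.

End GradedQuotients.

(* h d = dim (K[x_0..x_n]/I)_d; the subspace V is the graded component I_d.
   The number of variables is a successor because the library makes
   [dhomog n K d] a [vectType] only then. *)
Definition hilbert_function (K : fieldType) (n : nat)
    (I : {mpoly K[n.+1]} -> Prop) (h : nat -> nat) : Prop :=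
  forall d, exists2 V : {vspace dhomog n.+1 K d},
    forall p : dhomog n.+1 K d, p \in V <-> I (mpoly_of_dhomog p) &
    h d + \dim V = \dim (fullv : {vspace dhomog n.+1 K d}).

Definition AG3_hilbert_function (K : fieldType) (j : nat) (h : nat -> nat) :=
  exists I : {mpoly K[3]} -> Prop, graded_AG_ideal I j /\ hilbert_function I h.

(* Restricting to at least one variable loses nothing: a standard graded
   algebra may always be presented with an extra variable lying in I. *)
Definition O_sequence (K : fieldType) (h : nat -> nat) : Prop :=
  (forall d, h d = 0) \/
  exists (n : nat) (I : {mpoly K[n.+1]} -> Prop),
    homogeneous_ideal I /\ hilbert_function I h.

Section RankMatrices.

Variable N : nat.
Implicit Type M : 'M[nat]_N.

(* Entry (u, v) of M, extended by 0 outside the index range. *)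
Definition entry M (u v : nat) : nat :=
  if (insub u, insub v) is (Some i, Some j) then M i j else 0.

(* Entry (u - 1, v) of M, hence 0 when u = 0. *)
Definition entry_above M (u v : nat) : nat :=
  if u is u'.+1 then entry M u' v else 0.

Definition diagonal M (i : nat) : nat -> nat := fun u => entry M u (u + i).

Definition shift (h : nat -> nat) : nat -> nat :=
  fun u => if u is u'.+1 then h u' else 0.

End RankMatrices.

(* T = (t_0, ..., t_j) has size j + 1. *)
Record potential_rank_matrix (K : fieldType) (T : seq nat)
    (M : 'M[nat]_(size T)) : Prop := PotentialRankMatrix {
  prm_upper : forall u v : 'I_(size T), v < u -> M u v = 0;
  prm_diag0 : forall u, diagonal M 0 u = nth 0 T u;
  prm_diag1 : exists u, diagonal M 1 u <> 0;
  prm_AG : forall i, i < size T ->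
    (forall u, diagonal M i u = 0) \/
    AG3_hilbert_function K ((size T).-1 - i) (diagonal M i);
  prm_Oseq : forall i, i < size T ->
    exists2 h, O_sequence K h &
      forall u, ((diagonal M i u)%:Z - (shift (diagonal M i.+1) u)%:Z
                 = (h u)%:Z)%R;
  prm_rows : forall u v, u <= v -> v.+1 < size T ->
    entry M u v.+1 <= entry M u v;
  prm_cols : forall u v, u < v -> v < size T ->
    entry M u v <= entry M u.+1 v;
  prm_exchange : forall u v, u < v -> v < (size T).-1 ->
    entry M u v + entry M u.+1 v.+1 <= entry M u.+1 v + entry M u v.+1;
  prm_plateau : forall u v u' v',
    u <= v -> v < size T -> u' <= v' -> v' < size T ->
    nth 0 T u = \max_(t <- T) t -> nth 0 T v = \max_(t <- T) t ->
    nth 0 T u' = \max_(t <- T) t -> nth 0 T v' = \max_(t <- T) t ->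
    v - u = v' - u' -> entry M u v = entry M u' v'
}.

(* The pair (p, nu) stands for a string of length p starting in degree nu. *)
Definition jordan_degree_type_of (N : nat) (M : 'M[nat]_N)
    (S : {mset (nat * nat)}) : Prop :=
  (forall u v, u <= v -> v < N ->
     ((S ((v - u + 1)%N, u))%:Z
      = (entry M u v)%:Z + (entry_above M u v.+1)%:Z
        - (entry_above M u v)%:Z - (entry M u v.+1)%:Z)%R) /\
  (forall x, x \in S -> exists u v, [/\ u <= v, v < N & x = (v - u + 1, u)]).

Definition potential_jordan_degree_type (K : fieldType) (T : seq nat)
    (S : {mset (nat * nat)}) : Prop :=
  exists2 M : 'M[nat]_(size T),
    potential_rank_matrix K M & jordan_degree_type_of M S.

(* Main.v *)
From HB Require Import structures.
Require Import Defs.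
From mathcomp Require Import all_boot all_order all_algebra.
From mathcomp.multinomials Require Import mpoly.
From mathcomp.finmap Require Import finmap multiset.
From mathcomp Require Import zify.

(** Put [j = k + 3]. The diagonals [H(i)] of a potential rank matrix are zero or
    Hilbert functions of Gorenstein algebras, so they are symmetric
    ([AG_hilbert_symmetric]: multiplication into the one-dimensional top degree
    is a perfect pairing). Condition (v) makes them constant away from the two
    degrees at either end. Hence [H(i) = (a, b, c, ..., c, b, a)], and the matrix
    amounts to the word of states [(a_i, b_i, c_i)], [0 <= i <= j], whose first
    state is [(1, 3, 5)] ([matrix_word_words]).

    In terms of states, conditions (iii) and (iv) become inequalities between
    two or three consecutive states; for instance [c_i] is non-increasing and
    convex. If [H(i+1)] is nonzero, the O-sequence [H(i) - (0, H(i+1))] starts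
    with [1, b_i - 1, ...] where [b_i - 1 <= 2], so it belongs to an algebra
    generated by two linear forms and obeys Macaulay's bound in its simplest
    form: at most [d + 1] in degree [d], and no growth once it is at most [d]
    ([two_generated_growth]). When [H(i+1)] is zero, the same bound applies to
    [H(i)] if [b_i <= 2]. All these constraints are collected in the boolean
    [step], which sees the position in the word only through the distance to its
    end, and through that distance only when it is less than 4.

    Because the first differences of [c] bound those of [b], which bound those of
    [a], one index later each time, a repeated state is repeated until the last
    four states of the word. A repetition must occur after five steps from
    [(1, 3, 5)], so that for long words repeating the sixth state once more
    is a bijection onto the words one letter longer. The number of words
    is thus found by enumeration for [k = 4, ..., 7] and persists for larger [k]:
    it is 47 ([words_count]).

    The same enumeration and bijection show that each nonzero diagonal of a word
    has a Hilbert function [(1, b, c, ..., c, b, 1)] with [(b, c)] one of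
    six pairs. It is realized by the apolar algebra of a sum of evaluations at
    [c] of the points [e0, e1, e2, e0+e1, e0+e2] of the plane
    ([profile_gorenstein]). The differences required in (ii) are realized by
    monomial ideals in two variables ([O_sequence_of_growth]), so every word
    gives a potential rank matrix ([word_potential]).

    Finally the Jordan degree type is a mixed second difference of the matrix
    entries: (iii) and (iv) say that the multiplicities are non-negative, and
    the entries are recovered by summation ([jordan_type_inj]). *)

Set Implicit Arguments.
Unset Strict Implicit.
Unset Printing Implicit Defensive.

Import GRing.Theory.

Local Open Scope mset_scope.
Local Open Scope nat_scope.

(** * Codimension of common kernels *)

Section LinearAlgebra.

Variable K : fieldType.
Local Open Scope ring_scope.

Lemma lfun_of_linear (U W : vectType K) (f : U -> W) :
  linear f -> {g : 'Hom(U, W) | g =1 f}.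
Proof.
move=> lin_f.
pose fL : {linear U -> W} := HB.pack f (GRing.isLinear.Build K U W _ f lin_f).
by exists (linfun fL) => u; rewrite lfunE.
Qed.

(** The subspace is produced as data, so that Hilbert functions can be defined
    from it degree by degree without a choice principle. *)
Lemma common_kernel (W : vectType K) m (f : 'I_m -> W -> K) :
    (forall i, linear (f i : W -> K^o)) ->
  {V : {vspace W} |
    [/\ forall w, w \in V <-> forall i, f i w = 0,
        (\dim {:W} <= m + \dim V)%N
      & (forall i, exists w, forall k, f k w = (k == i)%:R) ->
        (m + \dim V)%N = \dim {:W}]}.
Proof.
move=> lin_f.
have [|F FE] := @lfun_of_linear W 'rV[K]_m (fun w => \row_i f i w).
  by move=> a u v; apply/rowP => i; rewrite !mxE lin_f.
have dimF : (\dim (limg F) + \dim (lker F))%N = \dim {:W}.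
  by rewrite -(limg_ker_dim F fullv) capfv addnC.
have dim_row : \dim {: 'rV[K]_m} = m by rewrite dimvf /dim /= mul1n.
exists (lker F); split=> [w||sur].
- rewrite memv_ker FE; split=> [/eqP/rowP f0 i|f0].
    by have := f0 i; rewrite !mxE.
  by apply/eqP/rowP => i; rewrite !mxE f0.
- by rewrite -dimF leq_add2r -[leqRHS]dim_row dimvS ?subvf.
suff fullF : limg F = fullv by rewrite -dimF fullF dim_row.
apply/eqP; rewrite eqEsubv subvf; apply/subvP => y _.
rewrite (row_sum_delta y) memv_suml // => i _; apply: memvZ.
have [w fw] := sur i; suff -> : delta_mx 0 i = F w by rewrite memv_img ?memvf.
by rewrite FE; apply/rowP => k; rewrite !mxE eqxx fw.
Qed.

(** A vector lies in [VW] as soon as it pairs to zero with a basis of a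
    complement of [VU], so the codimension of [VW] is at most that of [VU].
    Applied in both directions this turns nondegeneracy into an equality of
    dimensions. *)
Lemma pairing_codim_le (U W : vectType K) (B : U -> W -> K)
    (VU : {vspace U}) (VW : {vspace W}) :
    (forall w, linear (B^~ w : U -> K^o)) ->
    (forall u, linear (B u : W -> K^o)) ->
    (forall u, u \in VU -> forall w, B u w = 0) ->
    (forall w, w \in VW <-> forall u, B u w = 0) ->
  (\dim {:W} + \dim VU <= \dim {:U} + \dim VW)%N.
Proof.
move=> linl linr kerU kerW; pose X := vbasis VU^C.
have [i|V [memV le _]] := @common_kernel W (\dim VU^C) (fun i => B X`_i).
  exact: linr.
have VE : V = VW.
  apply/vspaceP => w; apply/idP/idP => [/memV B0|/kerW B0]; last exact/memV.
  apply/kerW => u.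
  have /memv_addP [u1 u1V [u2 u2V ->]] : u \in (VU + VU^C)%VS.
    by rewrite addv_complf memvf.
  have [/= g gE] := lfun_of_linear (linl w).
  rewrite -gE linearD /= gE (kerU _ u1V) add0r (coord_vbasis u2V) linear_sum.
  by rewrite big1 // => i _; rewrite linearZ /= gE B0 scaler0.
rewrite VE dimv_compl in le.
have := dimvS (subvf VU); lia.
Qed.

End LinearAlgebra.

(** * Homogeneous components *)

Lemma linear_mul_homog (K : fieldType) n d (l p : {mpoly K[n]}) :
  l \is 1.-homog -> p \is d.-homog -> (l * p)%R \is d.+1.-homog.
Proof. by move=> hl hp; rewrite -add1n; apply: dhomogM. Qed.

Lemma var_homog (K : fieldType) n (i : 'I_n) : ('X_i : {mpoly K[n]})%R \is 1.-homog.
Proof. by rewrite dhomogX /= mdeg1. Qed.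
Hint Resolve var_homog : core.

Lemma mnm_factor n (m : 'X_{1..n}) :
  m != 0%MM -> exists i m', m = (U_(i) + m')%MM.
Proof.
move=> Nm; have [i mi] : exists i, m i != 0.
  apply/existsP; apply: contraNT Nm; rewrite negb_exists => /forallP m0.
  by apply/eqP/mnmP => i; rewrite mnm0E; apply/eqP; rewrite -[_ == _]negbK m0.
exists i, (m - U_(i))%MM; rewrite addmC submK //; apply/mnm_lepP => k.
by rewrite mnm1E; case: eqP => // <-; rewrite lt0n.
Qed.

Lemma mcoeff_pihomog (K : fieldType) n d (p : {mpoly K[n]}) m :
  ((pihomog mdeg d p)@_m = if mdeg m == d then p@_m else 0)%R.
Proof.
elim/mpolyind: p => [|c k p _ _ IHp]; first by rewrite linear0 mcoeff0 if_same.
rewrite linearP /= !mcoeffD !mcoeffZ IHp pihomogX [in RHS]mcoeffX.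
have [dk|Nk] := eqVneq (mdeg k) d; last first.
  rewrite mcoeff0 mulr0 add0r; case: eqP => // dm.
  by case: eqP dm => [<- /eqP|]; rewrite ?(negPf Nk) // mulr0 add0r.
rewrite mcoeffX; case: ifP => // /eqP Nm; case: eqP => [km|]; last by rewrite mulr0 addr0.
by case: Nm; rewrite -km.
Qed.

Lemma pihomogMl (K : fieldType) n d k (f q : {mpoly K[n]}) : f \is d.-homog ->
  pihomog mdeg k (f * q)%R = (if (d <= k)%N then f * pihomog mdeg (k - d)%N q else 0)%R.
Proof.
move=> hf; elim/mpolyind: q => [|c m q _ _ IHq].
  by rewrite mulr0 !linear0 mulr0 if_same.
rewrite mulrDr !linearD /= IHq -scalerAr !linearZ /= pihomogX.
have hfm : (f * 'X_[m])%R \is (d + mdeg m).-homog.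
  by apply: dhomogM => //; rewrite dhomogX /=.
have [<-|Nk] := eqVneq (d + mdeg m) k.
  by rewrite pihomog_dE // leq_addr addKn eqxx mulrDr scalerAr.
rewrite (pihomog_ne0 Nk hfm) scaler0 add0r; case: leqP => // le_dk.
suff /negPf-> : mdeg m != (k - d)%N by rewrite scaler0 add0r.
by apply: contraNneq Nk => ->; rewrite subnKC.
Qed.

Section DegreeParts.

Variables (K : fieldType) (n : nat).
Local Open Scope ring_scope.

Lemma ideal_scale (J : {mpoly K[n.+1]} -> Prop) (c : K) p :
  homogeneous_ideal J -> J p -> J (c *: p).
Proof. by move=> idJ Jp; rewrite -mul_mpolyC; apply: hidealM. Qed.

Lemma ideal_sub (J : {mpoly K[n.+1]} -> Prop) p q :
  homogeneous_ideal J -> J p -> J q -> J (p - q).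
Proof.
by move=> idJ Jp Jq; rewrite -[- q]scaleN1r; apply: hidealD => //; apply: ideal_scale.
Qed.

Lemma val_dhomogBZ d (p q : dhomog n.+1 K d) c :
  mpoly_of_dhomog (p - c *: q) = mpoly_of_dhomog p - c *: mpoly_of_dhomog q.
Proof. by rewrite !linearB; congr (_ - _); rewrite linearZ. Qed.

Lemma val_dhomogDZ d (p q : dhomog n.+1 K d) c :
  mpoly_of_dhomog (c *: p + q) = c *: mpoly_of_dhomog p + mpoly_of_dhomog q.
Proof. by rewrite linearP. Qed.

Definition degree_part d (f : {mpoly K[n.+1]}) : dhomog n.+1 K d :=
  DHomog (pihomogP mdeg d f).

Lemma degree_partP d : linear (degree_part d).
Proof. by move=> a f g; apply: val_inj; rewrite /= linearP. Qed.

Lemma degree_partZ d c f : degree_part d (c *: f) = c *: degree_part d f.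
Proof. by apply: val_inj; rewrite /= linearZ. Qed.

Lemma degree_part_sum d (T : Type) (s : seq T) (c : T -> K) F :
  degree_part d (\sum_(i <- s) c i *: F i) = \sum_(i <- s) c i *: degree_part d (F i).
Proof.
have h0 : degree_part d 0 = 0 by apply: val_inj; rewrite /= linear0.
by elim: s => [|i s IHs]; rewrite ?big_nil // !big_cons degree_partP IHs.
Qed.

Lemma degree_part_val d f : f \is d.-homog -> mpoly_of_dhomog (degree_part d f) = f.
Proof. by move=> hf; rewrite /= pihomog_dE. Qed.

Lemma degree_part_id d (p : dhomog n.+1 K d) : degree_part d (mpoly_of_dhomog p) = p.
Proof. by apply: val_inj; rewrite /= pihomog_dE ?dhomog_is_dhomog. Qed.

Lemma linear_form_map (l : {mpoly K[n.+1]}) d :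
  {F : 'Hom(dhomog n.+1 K d, dhomog n.+1 K d.+1) |
    forall p, F p = degree_part d.+1 (l * mpoly_of_dhomog p)}.
Proof.
apply: lfun_of_linear => a p q.
by rewrite val_dhomogDZ mulrDr -scalerAr degree_partP.
Qed.

End DegreeParts.

(** * Gorenstein duality *)

Section GorensteinDuality.

Variables (K : fieldType) (n : nat) (I : {mpoly K[n.+1]} -> Prop) (j : nat).
Local Open Scope ring_scope.

Hypothesis AG : graded_AG_ideal I j.
Let idI := AG_homogeneous AG.

Lemma top_in_socle p : p \is j.-homog -> in_socle I p.
Proof.
move=> hp i; exact: AG_above_top AG _ _ (ltnSn j) (linear_mul_homog _ hp).
Qed.

(** The socle is a line and already contains a form of degree [j]; a socle
    element of lower degree is proportional to it modulo [I], and comparing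
    degree [j] components leaves only zero. *)
Lemma socle_below_top d p :
  (d < j)%N -> p \is d.-homog -> in_socle I p -> I p.
Proof.
move=> ltdj hp socp; have [g [_ Ng gen]] := AG_socle_dim1 AG.
have [c Ic] := gen _ socp; have [p0 h0 N0] := AG_top_nonzero AG.
have [c0 Ic0] := gen _ (top_in_socle h0).
have [c_0|nzc] := eqVneq c 0; first by rewrite c_0 scale0r subr0 in Ic.
case: N0; have: I (p0 - (c0 / c) *: p).
  have -> : p0 - (c0 / c) *: p = (p0 - c0 *: g) - (c0 / c) *: (p - c *: g).
    by rewrite scalerBr scalerA divfK // opprB addrA addrNK.
  by apply: ideal_sub => //; apply: ideal_scale.
move/(hideal_homog idI j); rewrite linearB linearZ /= (pihomog_dE h0).
by rewrite (pihomog_ne0 (b := j) _ hp) ?scaler0 ?subr0 // ltn_eqF.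
Qed.

(** Nondegeneracy of the multiplication pairing into the socle degree: a form
    killed by all forms of complementary degree is, by induction on that degree,
    killed by the variables, so it lies in the socle, which lives in degree [j]. *)
Lemma pairing_nondegenerate e d p :
    (d + e)%N = j -> p \is d.-homog ->
    (forall q : {mpoly K[n.+1]}, q \is e.-homog -> I (p * q)) -> I p.
Proof.
elim: e d p => [|e IHe] d p de hp killp.
  by have := killp 1 (dhomog1 _ _); rewrite mulr1.
apply: (@socle_below_top d) => //; first by rewrite -de addnS ltnS leq_addr.
move=> i; apply: (IHe d.+1) => [|| q hq]; first by rewrite addSn -addnS.
  exact: linear_mul_homog.
rewrite mulrAC mulrC; apply: killp.
exact: linear_mul_homog.
Qed.

Lemma top_generated p0 p :
  p0 \is j.-homog -> ~ I p0 -> p \is j.-homog -> exists c : K, I (p - c *: p0).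
Proof.
move=> h0 N0 hp; have [g [_ Ng gen]] := AG_socle_dim1 AG.
have [c Ic] := gen _ (top_in_socle hp); have [c0 Ic0] := gen _ (top_in_socle h0).
have [c0_0|nzc0] := eqVneq c0 0; first by rewrite c0_0 scale0r subr0 in Ic0.
exists (c / c0).
have -> : p - (c / c0) *: p0 = (p - c *: g) - (c / c0) *: (p0 - c0 *: g).
  by rewrite scalerBr scalerA divfK // opprB addrA addrNK.
by apply: ideal_sub => //; apply: ideal_scale.
Qed.

Variable h : nat -> nat.
Hypothesis Hh : hilbert_function I h.

(** As the degree [j] part of the quotient is a line, it may be read through a
    linear functional that only sees the degree [j] component. *)
Lemma top_functional : exists L : {mpoly K[n.+1]} -> K,
  linear (L : {mpoly K[n.+1]} -> K^o) /\
  (forall p, p \is j.-homog -> (L p = 0 <-> I p)).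
Proof.
have [V memV _] := Hh j; have [p0 h0 N0] := AG_top_nonzero AG.
pose P0 : dhomog n.+1 K j := DHomog h0.
have cap0 : (<[P0]> :&: V = 0)%VS.
  apply/eqP; rewrite -subv0; apply/subvP => v /memv_capP [/vlineP [c ->] cV].
  have [->|nzc] := eqVneq c 0; first by rewrite scale0r mem0v.
  by case: N0; apply/(memV P0); rewrite -(scalerK nzc P0) memvZ.
have full p : p \in (<[P0]> + V)%VS.
  have [c Ic] := top_generated h0 N0 (dhomog_is_dhomog p).
  rewrite -(subrK (c *: P0) p) addrC memv_add ?memvZ ?memv_line //.
  by apply/memV; rewrite val_dhomogBZ.
have cap0' : (V :&: <[P0]> = 0)%VS by rewrite capvC.
pose pr := daddv_pi <[P0]> V.
pose l p := coord [tuple P0] ord0 (pr p).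
exists (fun f => l (degree_part j f)); split=> [a f g | p hp].
  by rewrite /l degree_partP !linearP.
have -> : degree_part j p = DHomog hp by apply: val_inj; rewrite /= pihomog_dE.
set P := DHomog hp; apply: (iff_trans _ (memV P)).
have defP := daddv_pi_add cap0 (full P).
split=> [lP | PV]; last first.
  have PN : daddv_pi V <[P0]> P = P by rewrite daddv_pi_id.
  rewrite /l /pr; move: defP; rewrite PN => /(canRL (addrK _)) ->.
  by rewrite subrr linear0.
rewrite -defP; suff -> : daddv_pi <[P0]> V P = 0 by rewrite add0r memv_pi.
have : pr P \in <<[tuple P0]>>%VS by rewrite span_seq1 memv_pi.
by move/coord_span => ->; rewrite big_ord1 -/(l P) lP scale0r.
Qed.

Lemma AG_hilbert_le d e : (d + e)%N = j -> (h e <= h d)%N.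
Proof.
move=> dj; have [L [linL L0]] := top_functional.
have [VU memU dimU] := Hh d; have [VW memW dimW] := Hh e.
pose B (p : dhomog n.+1 K d) (q : dhomog n.+1 K e) : K :=
  L (mpoly_of_dhomog p * mpoly_of_dhomog q).
have hom (p : dhomog n.+1 K d) (q : dhomog n.+1 K e) :
    mpoly_of_dhomog p * mpoly_of_dhomog q \is j.-homog.
  by have := dhomogM (dhomog_is_dhomog p) (dhomog_is_dhomog q); rewrite dj.
suff : (\dim {: dhomog n.+1 K e} + \dim VU <=
         \dim {: dhomog n.+1 K d} + \dim VW)%N by lia.
apply: (@pairing_codim_le K _ _ B).
- by move=> q a p p'; rewrite /B val_dhomogDZ mulrDl -scalerAl linL.
- by move=> p a q q'; rewrite /B val_dhomogDZ mulrDr -scalerAr linL.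
- move=> p /memU Ip q; apply/L0; first exact: hom.
  by rewrite mulrC; apply: hidealM.
move=> q; split=> [/memW Iq p | B0].
  by apply/L0; [exact: hom | apply: hidealM].
apply/memW; apply: (@pairing_nondegenerate d e); first by rewrite addnC.
  exact: dhomog_is_dhomog.
move=> p hp; rewrite mulrC; apply/L0; last exact: (B0 (DHomog hp)).
exact: (hom (DHomog hp)).
Qed.

Lemma AG_hilbert_symmetric d : (d <= j)%N -> h d = h (j - d)%N.
Proof.
by move=> ledj; apply/eqP; rewrite eqn_leq !AG_hilbert_le ?subnK ?subnKC.
Qed.

Lemma AG_hilbert_above d : (j < d)%N -> h d = 0%N.
Proof.
move=> ltjd; have [V memV dimV] := Hh d.
suff VT : V = fullv.
  by move: dimV; rewrite VT => /eqP; rewrite -[X in _ == X]add0n eqn_add2r => /eqP.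
apply/eqP; rewrite eqEsubv subvf; apply/subvP => p _; apply/memV.
exact: AG_above_top ltjd (dhomog_is_dhomog p).
Qed.

Lemma AG_hilbert_le1 : (h j <= 1)%N.
Proof.
have [V memV dimV] := Hh j; have [p0 h0 N0] := AG_top_nonzero AG.
pose P0 : dhomog n.+1 K j := DHomog h0.
suff VT : (<[P0]> + V)%VS = fullv.
  have [+ _] := dimv_add_leqif <[P0]>%VS V.
  by rewrite VT -dimV leq_add2r => /leq_trans-> //; rewrite dim_vline leq_b1.
apply/eqP; rewrite eqEsubv subvf; apply/subvP => p _.
have [c Ic] := top_generated h0 N0 (dhomog_is_dhomog p).
rewrite -(subrK (c *: P0) p) addrC memv_add ?memvZ ?memv_line //.
by apply/memV; rewrite val_dhomogBZ.
Qed.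

Lemma AG_hilbert0 : h 0%N = 1%N.
Proof.
have h0j := AG_hilbert_symmetric (leq0n j); rewrite subn0 in h0j.
apply/eqP; rewrite eqn_leq {1}h0j AG_hilbert_le1 /= lt0n.
have [p0 hp0 N0] := AG_top_nonzero AG.
apply/eqP => h00; have [V memV dimV] := Hh 0%N.
have VT : V = fullv by apply/eqP; rewrite eqEdim subvf -dimV h00 add0n leqnn.
case: N0; rewrite -[p0]mulr1; apply: hidealM => //.
have h1 : (1 : {mpoly K[n.+1]}) \is 0.-homog by apply: dhomog1.
by apply/(memV (DHomog h1)); rewrite VT memvf.
Qed.

End GorensteinDuality.

(** * Growth of algebras generated by two linear forms *)

Section MacaulayGrowth.

Variables (K : fieldType) (n : nat).
Local Open Scope ring_scope.

Variables (I : {mpoly K[n.+1]} -> Prop) (h : nat -> nat).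
Hypotheses (idI : homogeneous_ideal I) (Hh : hilbert_function I h).
Hypothesis h1 : (h 1%N <= 2)%N.

(** A complement of the linear forms of [I] has dimension [h 1 <= 2]; a missing
    generator is padded with zero. *)
Lemma linear_generators : exists a b : {mpoly K[n.+1]},
  [/\ a \is 1.-homog, b \is 1.-homog &
      forall l, l \is 1.-homog ->
        exists s t : K, I (l - (s *: a + t *: b))].
Proof.
have [V memV dimV] := Hh 1%N.
have sp2 (s : seq (dhomog n.+1 K 1)) : (size s <= 2)%N ->
    (<<s>> <= <[s`_0]> + <[s`_1]>)%VS.
  case: s => [|x [|y [|]]] //= _.
  - by rewrite span_nil sub0v.
  - by rewrite span_seq1 addvSl.
  - by rewrite span_cons span_seq1.
pose X := vbasis V^C; exists (mpoly_of_dhomog X`_0), (mpoly_of_dhomog X`_1).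
split; try exact: dhomog_is_dhomog.
move=> l hl; have : DHomog hl \in (V + V^C)%VS by rewrite addv_complf memvf.
case/memv_addP => v vV [w wV lE].
have : w \in (<[X`_0]> + <[X`_1]>)%VS.
  apply: subv_trans (sp2 X _); last by rewrite size_tuple dimv_compl -dimV; lia.
  by rewrite (span_basis (vbasisP _)) -memvE.
case/memv_addP => _ /vlineP [s ->] [_ /vlineP [t ->] wE].
exists s, t; have -> : l = mpoly_of_dhomog v + mpoly_of_dhomog w.
  by rewrite -[l]/(mpoly_of_dhomog (DHomog hl)) lE linearD.
rewrite wE linearD !linearZ addrK; exact/memV.
Qed.

Variables (a b : {mpoly K[n.+1]}).
Hypotheses (ha : a \is 1.-homog) (hb : b \is 1.-homog).
Hypothesis gen_ab :
  forall l, l \is 1.-homog -> exists s t : K, I (l - (s *: a + t *: b)).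

Definition binomon d k : dhomog n.+1 K d := degree_part d (a ^+ k * b ^+ (d - k)).

Lemma binomon_homog d k : (k <= d)%N -> a ^+ k * b ^+ (d - k) \is d.-homog.
Proof.
move=> le_kd; have hk c k' : c \is 1.-homog -> c ^+ k' \is [in K[n.+1], k'.-homog].
  by move=> hc; have := dhomogMn k' hc; rewrite mul1n.
by have := dhomogM (hk a k ha) (hk b (d - k)%N hb); rewrite subnKC.
Qed.

Lemma val_binomon d k : (k <= d)%N ->
  mpoly_of_dhomog (binomon d k) = a ^+ k * b ^+ (d - k).
Proof. by move=> le_kd; rewrite degree_part_val ?binomon_homog. Qed.

(** [initial_span V k] collects, modulo [V], the first [k] monomials
    [b^d, a b^(d-1), a^2 b^(d-2), ...]; a monomial outside the span of its
    predecessors is standard, and the standard ones form a basis modulo [V]. *)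
Definition initial_span d (V : {vspace dhomog n.+1 K d}) k :=
  (V + \sum_(i < k) <[binomon d i]>)%VS.

Definition standard d (V : {vspace dhomog n.+1 K d}) k :=
  binomon d k \notin initial_span V k.

Lemma initial_spanS d (V : {vspace dhomog n.+1 K d}) k :
  initial_span V k.+1 = (initial_span V k + <[binomon d k]>)%VS.
Proof. by rewrite /initial_span big_ord_recr addvA. Qed.

Lemma initial_span_le d (V : {vspace dhomog n.+1 K d}) k l :
  (k <= l)%N -> (initial_span V k <= initial_span V l)%VS.
Proof.
move/subnKC <-; elim: (l - k)%N => [|m IHm]; first by rewrite addn0.
by rewrite addnS initial_spanS (subv_trans IHm) // addvSl.
Qed.

(** Adding one vector raises the dimension exactly when it is standard. *)
Lemma dim_initial_span d (V : {vspace dhomog n.+1 K d}) k :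
  \dim (initial_span V k) = (\dim V + \sum_(i < k) standard V i)%N.
Proof.
elim: k => [|k IHk]; first by rewrite /initial_span !big_ord0 addv0 addn0.
rewrite initial_spanS big_ord_recr /= addnA -IHk /standard.
have [inU|ninU] /= := boolP (binomon d k \in _).
  by rewrite (addv_idPl _) ?addn0.
have nz : binomon d k != 0 by apply: contraNneq ninU => ->; exact: mem0v.
rewrite dimv_disjoint_sum ?dim_vline ?nz //.
apply/eqP; rewrite -subv0; apply/subvP => v /memv_capP [vU /vlineP [c vE]].
rewrite vE in vU *; have [->|nzc] := eqVneq c 0; first by rewrite scale0r mem0v.
by case/negP: ninU; rewrite -(scalerK nzc (binomon d k)) memvZ.
Qed.

Section Consecutive.

Variable d : nat.
Variables (V : {vspace dhomog n.+1 K d}) (V' : {vspace dhomog n.+1 K d.+1}).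
Hypothesis memV : forall p, p \in V <-> I (mpoly_of_dhomog p).
Hypothesis memV' : forall p, p \in V' <-> I (mpoly_of_dhomog p).

Lemma mul_in_piece l (p : dhomog n.+1 K d) :
  l \is 1.-homog -> I (l * mpoly_of_dhomog p) ->
  degree_part d.+1 (l * mpoly_of_dhomog p) \in V'.
Proof.
move=> hl Ip; apply/memV'; rewrite degree_part_val //.
exact: linear_mul_homog hl (dhomog_is_dhomog p).
Qed.

Lemma mul_b_span k (p : dhomog n.+1 K d) : (k <= d.+1)%N -> p \in initial_span V k ->
  degree_part d.+1 (b * mpoly_of_dhomog p) \in initial_span V' k.
Proof.
move=> le_kd pU; have [F FE] := linear_form_map b d.
rewrite -FE; suff: (F @: initial_span V k <= initial_span V' k)%VS.
  by move/subvP; apply; rewrite memv_img.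
rewrite limgD limg_sum addvS //.
  apply/subvP => _ /memv_imgP [q /memV Iq ->]; rewrite FE mul_in_piece //.
  exact: hidealM.
apply/subv_sumP => i _; rewrite limg_line FE.
have le_id : (i <= d)%N by rewrite -ltnS (leq_trans (ltn_ord i)).
apply: subv_trans (sumv_sup i _ (subvv _)) => //.
rewrite val_binomon //.
by rewrite /binomon mulrCA -exprS subSn ?subvv.
Qed.

Lemma mul_a_span k (p : dhomog n.+1 K d) : (k <= d.+1)%N -> p \in initial_span V k ->
  degree_part d.+1 (a * mpoly_of_dhomog p) \in initial_span V' k.+1.
Proof.
move=> le_kd pU; have [F FE] := linear_form_map a d.
rewrite -FE; suff: (F @: initial_span V k <= initial_span V' k.+1)%VS.
  by move/subvP; apply; rewrite memv_img.
rewrite limgD limg_sum addvS //.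
  apply/subvP => _ /memv_imgP [q /memV Iq ->]; rewrite FE mul_in_piece //.
  exact: hidealM.
apply/subv_sumP => i _; rewrite limg_line FE.
have le_id : (i <= d)%N by rewrite -ltnS (leq_trans (ltn_ord i)).
apply: subv_trans (sumv_sup (lift ord0 i) _ (subvv _)) => //.
rewrite val_binomon //.
by rewrite /binomon mulrA -exprS subSS.
Qed.

Lemma standard_b k : (k <= d)%N -> standard V' k -> standard V k.
Proof.
move=> le_kd; apply: contra => /(mul_b_span (leqW le_kd)).
by rewrite val_binomon // mulrCA -exprS -subSn.
Qed.

Lemma standard_a k : (k <= d)%N -> standard V' k.+1 -> standard V k.
Proof.
move=> le_kd; apply: contra => /(mul_a_span (leqW le_kd)).
by rewrite val_binomon // mulrA -exprS -subSS.
Qed.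

(** One nonstandard monomial suffices for the growth bound: standard monomials
    of degree [d+1] before it are multiples by [b], those after it multiples by
    [a], of standard monomials of degree [d], and it counts for neither. *)
Lemma count_standard_growth :
  (\sum_(i < d.+1) standard V i <= d)%N ->
  (\sum_(i < d.+2) standard V' i <= \sum_(i < d.+1) standard V i)%N.
Proof.
move=> le_d; have [/existsP [k Nk]|] := boolP [exists k : 'I_d.+1, ~~ standard V k].
  rewrite -!(big_mkord xpredT (fun i => nat_of_bool (standard _ i))).
  have lekd : (k <= d)%N by rewrite -ltnS.
  rewrite (@big_cat_nat _ _ _ k.+1) ?ltnS ?leqW //=.
  rewrite (@big_cat_nat _ _ _ k 0 d.+1) ?leqW //=.
  rewrite big_nat_recr //= (negPf (contra (standard_b lekd) Nk)) addn0.
  apply: leq_add.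
    rewrite !big_nat; apply: leq_sum => i /andP [_ ltik].
    have := @standard_b i (leq_trans (ltnW ltik) lekd).
    by case: (standard V' i) => // ->.
  rewrite big_add1 /= !big_nat; apply: leq_sum => i /andP [_ ltid].
  by have := @standard_a i ltid; case: (standard V' i.+1) => // ->.
rewrite negb_exists => /forallP allS.
suff sumE : (\sum_(i < d.+1) standard V i)%N = d.+1 by rewrite sumE ltnn in le_d.
rewrite -[RHS]card_ord -sum1_card; apply: eq_bigr => i _.
by have := allS i; rewrite negbK => ->.
Qed.

End Consecutive.

(** Modulo [I] every variable is a combination of [a] and [b], hence every
    monomial is a combination of the [a^i b^(d-i)]. *)
Lemma initial_span_full d (V : {vspace dhomog n.+1 K d}) :
  (forall p, p \in V <-> I (mpoly_of_dhomog p)) -> initial_span V d.+1 = fullv.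
Proof.
elim: d V => [|d IHd] V memV.
  apply/eqP; rewrite eqEsubv subvf; apply/subvP => p _.
  rewrite -(degree_part_id p) (mpolyE (mpoly_of_dhomog p)) degree_part_sum.
  apply: memv_suml => m _; apply: memvZ.
  have [/eqP|mN0] := eqVneq (mdeg m) 0%N.
    rewrite mdeg_eq0 => /eqP->; rewrite mpolyX0 initial_spanS.
    apply: (subvP (addvSr _ _)).
    by rewrite /binomon !expr0 mulr1 memv_line.
  rewrite (_ : degree_part 0 'X_[m] = 0) ?mem0v //.
  by apply: val_inj; rewrite /= (pihomog_ne0 mN0) // dhomogX.
have [V0 memV0 _] := Hh d.
apply/eqP; rewrite eqEsubv subvf; apply/subvP => p _.
rewrite -(degree_part_id p) (mpolyE (mpoly_of_dhomog p)) degree_part_sum.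
apply: memv_suml => m _; apply: memvZ.
have [dm|mNd] := eqVneq (mdeg m) d.+1; last first.
  rewrite (_ : degree_part d.+1 'X_[m] = 0) ?mem0v //.
  by apply: val_inj; rewrite /= (pihomog_ne0 mNd) // dhomogX.
have [|i [m' mE]] := @mnm_factor _ m; first by rewrite -mdeg_eq0 dm.
have dm' : mdeg m' = d by move: dm; rewrite mE mdegD mdeg1 add1n => -[].
have hm' : ('X_[m'] : {mpoly K[n.+1]}) \is d.-homog by rewrite dhomogX /= dm'.
pose q : dhomog n.+1 K d := DHomog hm'.
have [s [t Ist]] := gen_ab (var_homog K i).
have qU : q \in initial_span V0 d.+1 by rewrite (IHd _ memV0) memvf.
rewrite mE mpolyXD.
have -> : 'X_i * 'X_[m'] = 1 *: (('X_i - (s *: a + t *: b)) * mpoly_of_dhomog q)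
    + (s *: (a * mpoly_of_dhomog q) + t *: (b * mpoly_of_dhomog q)).
  by rewrite scale1r !scalerAl -!mulrDl subrK.
rewrite !degree_partP degree_partZ; apply: memvD.
  apply: memvZ; apply: (subvP (addvSl V _)); apply: (mul_in_piece memV).
    by apply: rpredB; [exact: var_homog | apply: rpredD; apply: rpredZ].
  by rewrite mulrC; apply: hidealM.
apply: memvD; apply: memvZ; first exact: (mul_a_span memV0 memV (leqnn _) qU).
apply: (subvP (initial_span_le _ (leqnSn _))).
exact: (mul_b_span memV0 memV (leqnn _) qU).
Qed.

Lemma hilbert_count d (V : {vspace dhomog n.+1 K d}) :
    (forall p, p \in V <-> I (mpoly_of_dhomog p)) ->
    (h d + \dim V)%N = \dim {: dhomog n.+1 K d} ->
  h d = (\sum_(i < d.+1) standard V i)%N.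
Proof.
move=> memV; rewrite -(initial_span_full memV) dim_initial_span addnC.
by move/addnI.
Qed.

End MacaulayGrowth.

(** Macaulay's growth bound for a standard graded algebra generated by two
    linear forms. *)
Lemma two_generated_growth (K : fieldType) n (I : {mpoly K[n.+1]} -> Prop) h :
    homogeneous_ideal I -> hilbert_function I h -> h 1 <= 2 ->
  forall d, h d <= d.+1 /\ (h d <= d -> h d.+1 <= h d).
Proof.
move=> idI Hh h1 d; have [a [b [ha hb gen]]] := linear_generators Hh h1.
have [V memV dimV] := Hh d; have [V' memV' dimV'] := Hh d.+1.
have hd := hilbert_count idI Hh ha hb gen memV dimV.
have hd' := hilbert_count idI Hh ha hb gen memV' dimV'.
split; last first.
  by rewrite hd hd'; apply: (count_standard_growth idI ha hb memV memV').
rewrite hd -[leqRHS]card_ord -sum1_card; apply: leq_sum => i _.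
exact: leq_b1.
Qed.

(** * Monomial ideals in two variables *)

Section MonomialIdeal.

Variables (K : fieldType).
Local Open Scope ring_scope.

Variable h : nat -> nat.
Hypothesis h_bound : forall d, (h d <= d.+1)%N.
Hypothesis h_growth : forall d, (h d <= d)%N -> (h d.+1 <= h d)%N.

Lemma growth_iter d e : (h d <= d)%N -> (h (d + e) <= h d)%N.
Proof.
move=> le_d; elim: e => [|e IHe]; first by rewrite addn0.
by rewrite addnS (leq_trans (h_growth _)) //; lia.
Qed.

(** In degree [d] the quotient keeps the monomials [x^i y^(d-i)] with
    [i < h d]. *)
Definition lex_ideal (p : {mpoly K[2]}) : Prop :=
  forall m : 'X_{1..2}, (m ord0 < h (mdeg m))%N -> p@_m = 0.

(** A monomial [x^i y^(d-i)] of the ideal has [h d <= i <= d], so from degree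
    [d] on [h] does not increase, and its multiples are in the ideal as well. *)
Lemma lex_ideal_homogeneous : homogeneous_ideal lex_ideal.
Proof.
have le_deg (k : 'X_{1..2}) : (k ord0 <= mdeg k)%N.
  by rewrite mdegE big_ord_recl leq_addr.
split=> [m _|p q Ip Iq m lt_m|a p Ip m lt_m|d p Ip m lt_m].
- exact: mcoeff0.
- by rewrite mcoeffD Ip ?Iq ?addr0.
- rewrite mcoeffM big1 // => -[k1 k2] /= /eqP mE; rewrite [X in _ * X]Ip ?mulr0 //.
  rewrite mE mnmDE mdegD in lt_m; have := @growth_iter (mdeg k2) (mdeg k1).
  have := le_deg k2; rewrite addnC; lia.
by rewrite mcoeff_pihomog Ip ?if_same.
Qed.

Definition bimonom (d i : nat) : 'X_{1..2} := (U_(ord0) *+ i + U_(ord_max) *+ (d - i))%MM.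

Lemma bimonom0 d i : bimonom d i ord0 = i.
Proof. by rewrite mnmDE !mulmnE !mnm1E mul1n mul0n addn0. Qed.

Lemma mdeg_bimonom d i : (i <= d)%N -> mdeg (bimonom d i) = d.
Proof. by move=> le_id; rewrite mdegD !mdegMn !mdeg1 !mul1n subnKC. Qed.

Lemma bimonomE (m : 'X_{1..2}) : m = bimonom (mdeg m) (m ord0).
Proof.
apply/mnmP => i; rewrite mnmDE !mulmnE !mnm1E mdegE big_ord_recl big_ord1.
case: i => [[|[|i]]] lti //=; last first.
  by rewrite mul0n mul1n add0n addKn; congr (m _); apply: val_inj.
by rewrite mul1n mul0n addn0; congr (m _); apply: val_inj.
Qed.

Lemma lex_ideal_hilbert : hilbert_function lex_ideal h.
Proof.
move=> d.
have [|V [memV _ dimV]] := @common_kernel K (dhomog 2 K d) (h d)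
  (fun (i : 'I_(h d)) (p : dhomog 2 K d) => (mpoly_of_dhomog p)@_(bimonom d i)).
  by move=> i a p q; rewrite val_dhomogDZ mcoeffD mcoeffZ.
have le_d (i : 'I_(h d)) : (i <= d)%N by rewrite -ltnS (leq_trans (ltn_ord i)).
exists V => [p|]; last first.
  apply: dimV => i.
  have hX : ('X_[bimonom d i] : {mpoly K[2]}) \is d.-homog.
    by rewrite dhomogX /= mdeg_bimonom.
  exists (DHomog hX) => k /=; rewrite mcoeffX.
  suff -> : (bimonom d i == bimonom d k) = (k == i) by [].
  apply/eqP/eqP => [bE|->] //; apply: ord_inj.
  by rewrite -(bimonom0 d k) -bE bimonom0.
split=> [/memV p0 m lt_m | Ip]; last first.
  by apply/memV => i; apply: Ip; rewrite bimonom0 mdeg_bimonom.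
have [dm|Nm] := eqVneq (mdeg m) d.
  rewrite dm in lt_m; by rewrite (bimonomE m) dm (p0 (Ordinal lt_m)).
exact: (dhomog_nemf_coeff (dhomog_is_dhomog p) Nm).
Qed.

(** Converse of Macaulay's bound in two variables. *)
Lemma O_sequence_of_growth : O_sequence K h.
Proof.
right; exists 1%N, lex_ideal; split; first exact: lex_ideal_homogeneous.
exact: lex_ideal_hilbert.
Qed.

End MonomialIdeal.

(** * Gorenstein algebras of linear functionals *)

Section InverseSystem.

Variables (K : fieldType) (n j : nat) (L : {mpoly K[n.+1]} -> K).
Local Open Scope ring_scope.

Hypothesis linL : forall c f g, L (c *: f + g) = c * L f + L g.
Hypothesis L_homog : forall f, L (pihomog mdeg j f) = L f.
Hypothesis L_neq0 : exists f, L f != 0.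

(** The forms annihilating a functional on degree [j] under contraction. *)
Definition annihilator p := forall q, L (p * q) = 0.

Lemma functional0 : L 0 = 0.
Proof. by have := linL (-1) 0 0; rewrite scaler0 addr0 mulN1r addNr. Qed.

Lemma annihilator_homogeneous : homogeneous_ideal annihilator.
Proof.
split=> [q|p p' Ap Ap' q|a p Ap q|d p Ap q].
- by rewrite mul0r functional0.
- by rewrite mulrDl -[p * q]scale1r linL Ap Ap' mulr0 addr0.
- by rewrite mulrAC mulrC; apply: Ap.
rewrite -L_homog (pihomogMl _ _ (pihomogP mdeg d p)).
case: leqP => [le_dj|_]; last exact: functional0.
have := Ap (pihomog mdeg (j - d) q); rewrite mulrC -L_homog.
by rewrite (pihomogMl _ _ (pihomogP mdeg (j - d) q)) leq_subr subKn // mulrC.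
Qed.

Lemma annihilator_homogP d p : p \is d.-homog -> (d <= j)%N ->
    (forall q, q \is (j - d)%N.-homog -> L (p * q) = 0) ->
  annihilator p.
Proof.
move=> hp le_dj Lp q; rewrite -L_homog (pihomogMl _ _ hp) le_dj.
exact/Lp/pihomogP.
Qed.

(** A form of degree [j] on which [L] does not vanish spans the socle: if the
    variables kill [p], then [q |-> L (p * q)] only sees the constant term of
    [q], as does the same functional for that form. *)
Lemma annihilator_gorenstein : graded_AG_ideal annihilator j.
Proof.
have [g0 Lg0] := L_neq0; pose g := pihomog mdeg j g0.
have Lg : L g != 0 by rewrite L_homog.
have hg : g \is j.-homog := pihomogP mdeg j g0.
have Ng : ~ annihilator g by move/(_ 1); rewrite mulr1; apply/eqP.
have above d p : (j < d)%N -> p \is d.-homog -> annihilator p.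
  by move=> ltjd hp q; rewrite -L_homog (pihomogMl _ _ hp) leqNgt ltjd functional0.
split; [exact: annihilator_homogeneous | by exists g | exact: above |].
exists g; split=> // [i | p socp].
  by apply: (above j.+1) => //; apply: linear_mul_homog.
exists (L p / L g) => q; elim/mpolyind: q => [|c m q _ _ IHq].
  by rewrite mulr0 functional0.
rewrite mulrDr -scalerAr linL IHq addr0.
have LB u v : L (u - (L p / L g) *: v) = L u - L p / L g * L v.
  by rewrite addrC -scaleNr linL addrC mulNr.
have [->|/mnm_factor [i [m' ->]]] := eqVneq m 0%MM.
  by rewrite mpolyX0 mulr1 LB divfK // subrr mulr0.
rewrite mpolyXD mulrA mulrBl -scalerAl mulrBl -scalerAl LB ![_ * 'X_i]mulrC socp.
by rewrite (above j.+1) ?mulr0 ?subrr ?mulr0 //; apply: linear_mul_homog.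
Qed.

End InverseSystem.

Section AnnihilatorPieces.

Variables (K : fieldType) (n j : nat) (L : {mpoly K[n.+1]} -> K).
Local Open Scope ring_scope.

Hypothesis linL : forall c f g, L (c *: f + g) = c * L f + L g.
Hypothesis L_homog : forall f, L (pihomog mdeg j f) = L f.

Lemma annihilator_piece d :
  {V : {vspace dhomog n.+1 K d} |
    forall p, p \in V <-> annihilator L (mpoly_of_dhomog p)}.
Proof.
pose X := vbasis {: dhomog n.+1 K (j - d)}.
have [|V [memV _ _]] := @common_kernel K (dhomog n.+1 K d)
    (\dim {: dhomog n.+1 K (j - d)})
    (fun i p => L (mpoly_of_dhomog p * mpoly_of_dhomog X`_i)).
  by move=> i a p q; rewrite val_dhomogDZ mulrDl -scalerAl linL.
exists V => p; split=> [/memV Vp|Ap]; last by apply/memV => i; apply: Ap.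
have hp := dhomog_is_dhomog p; have [le_dj|lt_jd] := leqP d j; last first.
  by move=> q; rewrite -L_homog (pihomogMl _ _ hp) leqNgt lt_jd functional0.
apply: (annihilator_homogP L_homog hp le_dj) => q hq.
have := coord_vbasis (memvf (DHomog hq)); move/(congr1 (@mpoly_of_dhomog _ _ _)).
rewrite /= linear_sum => ->; rewrite mulr_sumr.
apply: (big_ind (fun f => L f = 0)) => [|f g Lf Lg|i _]; first exact: functional0.
  by rewrite -[f]scale1r linL Lf Lg mulr0 addr0.
by rewrite linearZ /= -scalerAr -[_ *: _]addr0 linL Vp functional0 // mulr0 addr0.
Qed.

Lemma annihilator_hilbert_exists : exists h, hilbert_function (annihilator L) h.
Proof.
exists (fun d => \dim {: dhomog n.+1 K d} - \dim (sval (annihilator_piece d)))%N => d.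
exists (sval (annihilator_piece d)); first exact: (svalP (annihilator_piece d)).
by rewrite subnK // dimvS ?subvf.
Qed.

End AnnihilatorPieces.

(** * Gorenstein algebras of point configurations *)

Section Points.

Variables (K : fieldType) (n : nat) (T : finType) (pt : T -> 'I_n.+1 -> K).
Local Open Scope ring_scope.

(** Forms of degree [d] take arbitrary values on the points indexed by [A]. *)
Definition separated (A : {set T}) d :=
  forall i, i \in A -> exists2 q : {mpoly K[n.+1]}, q \is d.-homog &
    forall k, k \in A -> q.@[pt k] = (k == i)%:R.

Definition vanishes (A : {set T}) (p : {mpoly K[n.+1]}) :=
  forall i, i \in A -> p.@[pt i] = 0.

Definition evaluation_sum j (A : {set T}) (f : {mpoly K[n.+1]}) : K :=
  \sum_(i in A) (pihomog mdeg j f).@[pt i].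

Variables (j : nat) (A : {set T}).
Let L := evaluation_sum j A.

Lemma evaluation_sum_linear c f g : L (c *: f + g) = c * L f + L g.
Proof.
rewrite /L /evaluation_sum mulr_sumr -big_split; apply: eq_bigr => i _.
by rewrite linearP mevalD mevalZ.
Qed.

Lemma evaluation_sum_homog f : L (pihomog mdeg j f) = L f.
Proof. by rewrite /L /evaluation_sum pihomog_id. Qed.

(** If the points are separated in the complementary degree, testing [p] against
    a form that is 1 at one point and 0 at the others isolates each value. *)
Lemma annihilator_vanishes d p :
    (d <= j)%N -> separated A (j - d) -> p \is d.-homog ->
  annihilator L p <-> vanishes A p.
Proof.
move=> le_dj sepA hp.
have LE q : q \is (j - d)%N.-homog -> L (p * q) = \sum_(i in A) p.@[pt i] * q.@[pt i].
  move=> hq; apply: eq_bigr => i _; rewrite pihomog_dE ?mevalM //.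
  by have := dhomogM hp hq; rewrite subnKC.
split=> [Ap i iA|p0].
  have [q hq q_pt] := sepA i iA.
  have := Ap q; rewrite LE // (bigD1 i) //= q_pt // eqxx mulr1 big1 ?addr0 //.
  by move=> k /andP[kA /negPf Nk]; rewrite q_pt // Nk mulr0.
apply: (annihilator_homogP evaluation_sum_homog hp le_dj) => q /LE->.
by rewrite big1 // => i iA; rewrite p0 ?mul0r.
Qed.

Lemma vanishing_codim d (B : {set T}) (V : {vspace dhomog n.+1 K d}) :
    separated B d -> (forall p, p \in V <-> vanishes B (mpoly_of_dhomog p)) ->
  (#|B| + \dim V)%N = \dim {: dhomog n.+1 K d}.
Proof.
move=> sepB memV.
have [|V' [memV' _ dimV']] := @common_kernel K (dhomog n.+1 K d) #|B|
    (fun i p => (mpoly_of_dhomog p).@[pt (enum_val i)]).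
  by move=> i a p q; rewrite val_dhomogDZ mevalD mevalZ.
suff -> : V = V'.
  apply: dimV' => i; have [q hq q_pt] := sepB _ (enum_valP i).
  by exists (DHomog hq) => k; rewrite /= q_pt ?enum_valP // (inj_eq enum_val_inj).
apply/vspaceP => p; apply/idP/idP => [/memV Vp|/memV' V'p].
  by apply/memV' => i; apply: Vp; apply: enum_valP.
by apply/memV => i iB; rewrite -(enum_rankK_in iB iB) V'p.
Qed.

(** The annihilator of a sum of evaluations agrees with the ideal of the points
    in the lower half of the degrees, and duality gives the upper half. *)
Lemma points_gorenstein (B : nat -> {set T}) (h : nat -> nat) :
    (exists i, i \in A) ->
    (forall d, (d.*2 <= j)%N -> separated A (j - d)) ->
    (forall d, (d.*2 <= j)%N -> [/\ separated (B d) d, B d \subset A,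
       forall p : {mpoly K[n.+1]}, p \is d.-homog -> vanishes (B d) p -> vanishes A p
       & #|B d| = h d]) ->
    (forall d, (d <= j)%N -> h d = h (j - d)%N) ->
    (forall d, (j < d)%N -> h d = 0%N) ->
  graded_AG_ideal (annihilator L) j /\ hilbert_function (annihilator L) h.
Proof.
move=> [i0 i0A] sepA hB symm above.
have L_neq0 : exists f, L f != 0.
  have [q hq q_pt] := sepA 0%N (leq0n _) _ i0A; rewrite subn0 in hq.
  exists q; rewrite /L /evaluation_sum pihomog_dE // (bigD1 i0) //= q_pt // eqxx.
  rewrite big1 ?addr0 ?oner_eq0 // => k /andP[kA /negPf Nk].
  by rewrite q_pt // Nk.
have AG := annihilator_gorenstein evaluation_sum_linear evaluation_sum_homog L_neq0.
split=> //; have [h' Hh'] :=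
  annihilator_hilbert_exists evaluation_sum_linear evaluation_sum_homog.
suff hE d : h' d = h d by move=> d; rewrite -hE; apply: Hh'.
have [le_dj|lt_jd] := leqP d j; last first.
  by rewrite above // (AG_hilbert_above AG Hh').
wlog le2 : d le_dj / (d.*2 <= j)%N => [low|].
  have [|gt2] := leqP d.*2 j; first exact: low.
  rewrite (AG_hilbert_symmetric AG Hh') // symm // low ?leq_subr //; lia.
have [V memV dimV] := Hh' d; have [sepB subBA Bvan <-] := hB d le2.
apply/eqP; rewrite -(eqn_add2r (\dim V)) dimV; apply/eqP; symmetry.
apply: vanishing_codim sepB _ => p; have hp := dhomog_is_dhomog p.
apply: iff_trans (memV p) _.
apply: iff_trans (annihilator_vanishes le_dj (sepA d le2) hp) _.
split=> [vA i iB|]; last exact: Bvan.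
exact/vA/(subsetP subBA).
Qed.

End Points.

(** * Five points of the plane *)

Section FivePoints.

Variable K : fieldType.
Local Open Scope ring_scope.

(** The points [e0, e1, e2, e0+e1, e0+e2] of the plane. *)
Definition plane_point (i : 'I_5) (c : 'I_3) : K :=
  ((c == i :> nat) || ((2 < i) && ((c == 0 :> nat) || (c == i - 2 :> nat))))%N%:R.

Definition coordinate_points b : {set 'I_5} := [set i : 'I_5 | (i < b)%N].

(** The first [b] coordinate points, with [c - b] of the points [e0+e1, e0+e2];
    in degree one the latter impose no new condition when [c - b < b]. *)
Definition point_config b c : {set 'I_5} :=
  [set i : 'I_5 | (i < b)%N || ((2 < i) && (i < 3 + (c - b)))%N].

Lemma separated_sub d (A B : {set 'I_5}) :
  A \subset B -> separated plane_point B d -> separated plane_point A d.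
Proof.
move=> /subsetP AB sepB i iA; have [q hq q_pt] := sepB i (AB i iA).
by exists q => // k /AB; apply: q_pt.
Qed.

Lemma separated_constants : separated plane_point (coordinate_points 1) 0.
Proof.
move=> i; rewrite inE => i0; exists 1; first exact: dhomog1.
move=> k; rewrite inE meval1 => k0; suff -> : k = i by rewrite eqxx.
by apply: ord_inj; lia.
Qed.

Lemma separated_linear : separated plane_point (coordinate_points 3) 1.
Proof.
move=> i; rewrite inE => lti; exists 'X_(Ordinal lti); first exact: var_homog.
move=> k; rewrite inE mevalXU /plane_point /= => ltk.
by rewrite ltnNge -ltnS ltk orbF eq_sym.
Qed.

Let x (i : nat) : {mpoly K[3]} := 'X_(inord i).

Definition separator d (i : 'I_5) : {mpoly K[3]} :=
  let l3 := x 0 ^+ d.-1 * x 1 in let l4 := x 0 ^+ d.-1 * x 2 in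
  nth 0 [:: x 0 ^+ d - l3 - l4; x 1 ^+ d - l3; x 2 ^+ d - l4; l3; l4] i.

(** Lagrange polynomials: [x0^(d-1) x1] is nonzero only at [e0+e1] and
    [x0^(d-1) x2] only at [e0+e2], and they correct the pure powers at these two
    points. *)
Lemma separated_quadratic d : (1 < d)%N -> separated plane_point setT d.
Proof.
move=> gt1; have gt0 : (0 < d)%N by lia.
have gt0' : (0 < d.-1)%N by lia.
have hX k i : x i ^+ k \is [in K[3], k.-homog].
  by have := dhomogMn k (var_homog K (inord i : 'I_3)); rewrite mul1n.
have h1 i : x 0 ^+ d.-1 * x i \is [in K[3], d.-homog].
  by have := dhomogM (hX d.-1 0%N) (var_homog K (inord i)); rewrite addn1 prednK.
move=> i _; exists (separator d i).
  by case: i => [[|[|[|[|[|i]]]]] lti] //=; rewrite /separator /= ?rpredB ?hX ?h1.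
have xE l k : (l < 3)%N -> (x l).@[plane_point k] =
    ((l == k :> nat) || ((2 < k) && ((l == 0) || (l == k - 2))))%N%:R.
  by move=> ltl; rewrite mevalXU /plane_point inordK.
(* coordinates are 0 or 1, hence idempotent *)
have xXE l e k : (l < 3)%N -> (0 < e)%N ->
    (x l ^+ e).@[plane_point k] = (x l).@[plane_point k].
  move=> ltl; rewrite rmorphXn /= xE //; case: e => // e _.
  by case: (_ || _); rewrite ?expr1n // expr0n.
move=> k _; case: i => [[|[|[|[|[|i]]]]] lti] //=; rewrite /separator /=;
  rewrite !(mevalB, mevalM, xXE, xE) //; case: k => [[|[|[|[|[|k]]]]] ltk] //=;
  by rewrite ?mul1r ?mul0r ?subr0 ?subrr ?subr0.
Qed.

(** The sequence [(1, b, c, ..., c, b, 1)] in degrees [0, ..., r]. *)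
Definition profile (b c r u : nat) : nat :=
  if (u <= r)%N then nth c [:: 1%N; b] (minn u (r - u)) else 0%N.

Lemma eval_form1_add (p : {mpoly K[3]}) (u v w : 'I_3 -> K) :
  p \is 1.-homog -> (forall c, u c = v c + w c) -> p.@[u] = p.@[v] + p.@[w].
Proof.
move=> hp uE; rewrite -(pihomog_dE hp) pihomogE !rmorph_sum -big_split /=.
apply: eq_bigr => m /eqP m1; rewrite !mevalZ -mulrDr; congr (_ * _).
have [i [m' mE]] : exists i m', m = (U_(i) + m')%MM.
  by apply: mnm_factor; rewrite -mdeg_eq0 m1.
have m'0 : m' = 0%MM.
  by apply/eqP; rewrite -mdeg_eq0; move: m1; rewrite mE mdegD mdeg1; lia.
by rewrite mE m'0 addm0 !mevalXU uE.
Qed.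

Lemma eval_form0 (p : {mpoly K[3]}) (u v : 'I_3 -> K) :
  p \is 0.-homog -> p.@[u] = p.@[v].
Proof.
move=> hp; rewrite -(pihomog_dE hp) pihomogE !rmorph_sum /=.
apply: eq_bigr => m; rewrite mdeg_eq0 => /eqP->.
by rewrite !mevalZ mpolyX0 !meval1.
Qed.

Definition realizable_pairs := [:: (1, 1); (2, 2); (2, 3); (3, 3); (3, 4); (3, 5)]%N.

Lemma card_point_config b c :
  (b, c) \in realizable_pairs -> #|point_config b c| = c.
Proof.
have cardE (P : pred 'I_5) : #|[set i | P i]| = (\sum_(i < 5) P i)%N.
  by rewrite -sum1dep_card big_mkcond.
by rewrite cardE /realizable_pairs !inE => /or4P[|||/or3P[]] /eqP[-> ->];
  rewrite !big_ord_recl big_ord0.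
Qed.

Lemma card_coordinate_points b : (b <= 3)%N -> #|coordinate_points b| = b.
Proof.
move=> le3; rewrite -sum1dep_card big_mkcond !big_ord_recl big_ord0 /=.
by case: b le3 => [|[|[|[|b]]]].
Qed.

Lemma realizable_bounds b c :
  (b, c) \in realizable_pairs -> [/\ 0 < b <= 3, b <= c <= 5 & c - b < b]%N.
Proof. by rewrite /realizable_pairs !inE => /or4P[|||/or3P[]] /eqP[-> ->]. Qed.

(** With [r < 4] there is no middle degree, and the pairing already needs
    values separated in degree one, or zero, by coordinate points alone. *)
Lemma profile_gorenstein b c r :
    (b, c) \in realizable_pairs ->
    ((r < 4)%N -> c = b) -> ((r < 2)%N -> b = 1%N) ->
  AG3_hilbert_function K r (profile b c r).
Proof.
move=> bc cb b1; have [/andP[b0 b3] /andP[le_bc c5] lt_cb] := realizable_bounds bc.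
pose A := point_config b c.
exists (annihilator (evaluation_sum plane_point r A)).
pose B d := nth A [:: coordinate_points 1; coordinate_points b] d.
have inA0 : ord0 \in A by rewrite inE b0.
have subA1 : coordinate_points b \subset A.
  by apply/subsetP => i; rewrite !inE => ->.
have Asub : c = b -> A \subset coordinate_points b.
  by move=> cb'; apply/subsetP => i; rewrite !inE cb' subnn addn0; lia.
have sepA d : (1 < d)%N -> separated plane_point A d.
  by move=> gt1; apply: (separated_sub (subsetT _)); apply: separated_quadratic.
have sepC m d : (m <= d)%N -> coordinate_points m \subset coordinate_points d.
  by move=> le_md; apply/subsetP => i; rewrite !inE; lia.
apply: (points_gorenstein (B := B)).
- by exists ord0.
- move=> d le2; have [|le1] := ltnP 1 (r - d); first exact: sepA.
  have lt4 : (r < 4)%N by lia.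
  have [r2|r2] := leqP 2 r.
    rewrite (_ : r - d = 1)%N; last by lia.
    apply: separated_sub separated_linear.
    exact: subset_trans (Asub (cb lt4)) (sepC _ _ b3).
  move: (Asub (cb lt4)); rewrite b1 // => Asub1.
  have [r1|r1] := leqP 1 (r - d).
    rewrite (_ : r - d = 1)%N; last by lia.
    by apply: separated_sub separated_linear; apply: subset_trans Asub1 (sepC _ _ _).
  rewrite (_ : r - d = 0)%N; last by lia.
  exact: separated_sub separated_constants.
- move=> [|[|d]] le2; rewrite /B /=.
  + split; [exact: separated_constants | exact: subset_trans (sepC _ _ b0) subA1 | |].
      move=> p hp p0 i _; rewrite (eval_form0 _ (plane_point ord0) hp).
      by apply: p0; rewrite inE.
    by rewrite card_coordinate_points // /profile leq0n min0n.
  + split=> //; first by apply: separated_sub separated_linear; apply: sepC.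
      move=> p hp p0 i; rewrite inE => /orP[lti|/andP[gti lti]].
        by apply: p0; rewrite inE.
      have lt5 : (i - 2 < 5)%N by have := ltn_ord i; lia.
      rewrite (eval_form1_add hp (v := plane_point ord0)
        (w := plane_point (Ordinal lt5))).
        rewrite !p0 ?addr0 // inE //=.
        by lia.
      move=> k; rewrite /plane_point /=.
      have := ltn_ord k; have := ltn_ord i => lti5 ltk3.
      case: (k : nat) ltk3 => [|[|[|//]]] _;
      case: (i : nat) lti5 gti => [|[|[|[|[|//]]]]] //= _ _; rewrite ?addr0 ?add0r //.
    rewrite card_coordinate_points // /profile.
    by rewrite (_ : minn 1 (r - 1) = 1)%N ?ifT //; lia.
  rewrite nth_nil; split=> //; first exact: sepA.
  rewrite card_point_config // /profile ifT; last by lia.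
  by rewrite nth_default //=; lia.
- by move=> d le_d; rewrite /profile le_d leq_subr subKn // minnC.
by move=> d lt; rewrite /profile leqNgt lt.
Qed.

End FivePoints.

(** * Words of states *)

Definition state := (nat * nat * nat)%type.

(** The value of a diagonal at distance [m] from its nearer end, constant from
    distance 2 on. *)
Definition layer (s : state) (m : nat) : nat :=
  match m with 0 => s.1.1 | 1 => s.1.2 | _ => s.2 end.

(** Macaulay's bound for the difference of the diagonals with states
    [t = (A, B, C)] and [u = (a, b, c)], where [r + 1] is the last degree of the
    former. If [a = 1] the difference is [1, B-1, C-b, C-c, ..., C-c, B-b, 0];
    if [a = 0] the second diagonal vanishes and the difference is the first
    diagonal itself, constrained when [B <= 2]. *)
Definition growth_ok (r : nat) (t u : state) : bool :=
  let: (A, B, C) := t in let: (a, b, c) := u in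
  if a == 1 then
    ((2 < r) ==> ((B <= 2) ==> (C.+1 <= B + b)) && (C <= b + 3)) &&
    ((3 < r) ==> [&& (C <= b + 2) ==> (b <= c), C <= c + 4 & B + c <= C + b])
  else ((A == 1) && (B <= 2)) ==> ((0 < r) ==> (0 < B)) && ((2 < r) ==> (B <= C)).

(** The constraints on three consecutive states [s, t, u], of which [u] has [r]
    states after it. A state followed by [r] others carries an entry [b] only if
    [2 <= r] and an entry [c] only if [4 <= r], the missing ones being set to
    zero; the guards on [r] express which entries exist. The guarded clauses are
    in turn (iii) and (iv) between the first two layers and between the last
    two, (iv) on the plateau, and (iv) at the middle of a diagonal that has no
    plateau, where symmetry identifies the two middle entries. *)
Definition step (r : nat) (s t u : state) : bool :=
  let: (_, sb, sc) := s in let: (A, B, C) := t in let: (a, b, c) := u in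
  [&& [&& a <= 1, (a == 0) ==> (b == 0) && (c == 0),
          (r < 2) ==> (b == 0) & (r < 4) ==> (c == 0)],
      [&& a <= A, b <= B & c <= C],
      (0 < r) ==> (a <= B) && (A + B <= sb + a),
      (2 < r) ==> (b <= C) && (B + C <= sc + b),
      [&& (3 < r) ==> (2 * C <= sc + c), (r == 0) ==> (2 * A <= sb + a)
        & (r == 2) ==> (2 * B <= sc + b)]
    & growth_ok r t u].

Arguments step : simpl never.

(** [e] counts further states after the end of [w]; it serves to state the
    constraints on a prefix of a longer word. *)
Fixpoint admissible (e : nat) (s t : state) (w : seq state) : bool :=
  if w is u :: w' then step (e + size w') s t u && admissible e t u w' else true.

Definition below (t : state) : seq state :=
  [seq (p, c) | p <- [seq (a, b) | a <- iota 0 t.1.1.+1, b <- iota 0 t.1.2.+1],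
                c <- iota 0 t.2.+1].

Fixpoint completions (e n : nat) (s t : state) : seq (seq state) :=
  if n is n'.+1 then
    flatten [seq [seq u :: w | w <- completions e n' t u] |
              u <- below t & step (e + n') s t u]
  else [:: [::]].

Lemma completionsS e n s t : completions e n.+1 s t =
  flatten [seq [seq u :: w | w <- completions e n t u] |
            u <- below t & step (e + n) s t u].
Proof. by []. Qed.

Lemma mem_below t u :
  (u \in below t) = [&& u.1.1 <= t.1.1, u.1.2 <= t.1.2 & u.2 <= t.2].
Proof.
case: u => [[a b] c] /=; apply/idP/and3P => [|[la lb lc]].
  case/allpairsP => -[p c'] [/allpairsP[[a' b'] [a'in b'in pE] c'in uE]].
  move: uE pE c'in a'in b'in => [<- <-] [<- <-].
  by rewrite !mem_iota !add0n !ltnS.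
apply/allpairsP; exists ((a, b), c); split=> //; last by rewrite mem_iota ltnS.
by apply/allpairsP; exists (a, b); split; rewrite ?mem_iota ?ltnS.
Qed.

Lemma step_below r s t u : step r s t u -> u \in below t.
Proof.
rewrite mem_below; case: s t u => [[sa sb] sc] [[A B] C] [[a b] c].
by case/and4P=> _ /and3P[/= -> -> ->].
Qed.

Lemma mem_completions e n s t w :
  (w \in completions e n s t) = (size w == n) && admissible e s t w.
Proof.
elim: n s t w => [|n IHn] s t w; first by rewrite inE; case: w.
rewrite completionsS; apply/flatten_mapP/idP => [[u]|].
  rewrite mem_filter => /andP[stu _] /mapP[w' w'in ->] /=.
  by move: w'in; rewrite IHn => /andP[/eqP-> ->]; rewrite eqxx stu.
case: w => [|u w] //; rewrite [size _]/= [admissible _ _ _ _]/= eqSS.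
case/andP=> /eqP sz /andP[stu adw].
rewrite sz in stu; exists u; first by rewrite mem_filter stu (step_below stu).
by apply/mapP; exists w => //; rewrite IHn sz eqxx.
Qed.

Lemma below_uniq t : uniq (below t).
Proof.
apply: allpairs_uniq; rewrite ?iota_uniq //.
  by apply: allpairs_uniq; rewrite ?iota_uniq // => -[? ?] [? ?] _ _ [-> ->].
by move=> [? ?] [? ?] _ _ [-> ->].
Qed.

Lemma completions_uniq e n s t : uniq (completions e n s t).
Proof.
elim: n s t => [|n IHn] s t //; rewrite completionsS.
have: uniq [seq u <- below t | step (e + n) s t u] by rewrite filter_uniq ?below_uniq.
elim: [seq u <- below t | _] => [|u us IHus] //= /andP[Nu us_uniq].
rewrite cat_uniq IHus // map_inj_uniq ?IHn ?andbT => [|? ? [->]] //.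
apply/hasPn => w /flatten_mapP[v v_us /mapP[w' _ ->]].
by apply/mapP => -[w'' _ [uv _]]; rewrite -uv v_us in Nu.
Qed.

Definition start : state := (1, 3, 5).
(** A fictitious state before [start], whose last two entries, the only ones
    that [step] reads, are large enough to make (iv) vacuous at [start]. *)
Definition phantom : state := (0, 10, 10).

(** The words are listed without their first state [start]; the condition on the
    second state says that [H(1)] is nonzero. *)
Definition words n : seq (seq state) :=
  [seq w <- completions 0 n phantom start | (head start w).1.1 == 1].

(** The states whose diagonal, with last degree [r], will be realized by points;
    below degree 4 there is no entry [c], below degree 2 no entry [b]. *)
Definition realizable (r : nat) (s : state) : bool :=
  let: (a, b, c) := s in
  if a == 0 then (b == 0) && (c == 0)
  else if r < 2 then true else if r < 4 then 0 < b <= 3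
  else (b, c) \in realizable_pairs.

Fixpoint all_realizable (w : seq state) : bool :=
  if w is u :: w' then realizable (size w') u && all_realizable w' else true.

Lemma mem_words n (w : seq state) : (w \in words n) =
  [&& (head start w).1.1 == 1, size w == n & admissible 0 phantom start w].
Proof. by rewrite mem_filter mem_completions. Qed.

Lemma words_uniq n : uniq (words n).
Proof. by rewrite filter_uniq ?completions_uniq. Qed.

Lemma step_far_from_end r s t u : 4 <= r -> step r s t u = step 4 s t u.
Proof.
case: s t u => [[sa sb] sc] [[A B] C] [[a b] c]; rewrite /step /growth_ok.
by case: r => [|[|[|[|r]]]].
Qed.

Lemma step_far r r' s t u : 4 <= r -> 4 <= r' -> step r s t u -> step r' s t u.
Proof. by move=> ge4 ge4'; rewrite !(@step_far_from_end _ s t u). Qed.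

Lemma step_weaken r s s' t u : s \in below s' -> step r s t u -> step r s' t u.
Proof.
rewrite mem_below; case: s s' t u => [[sa sb] sc] [[sa' sb'] sc'] [[A B] C] [[a b] c].
rewrite /step /=; lia.
Qed.

(** A constant stretch satisfies the constraints of type (iv) with equality. *)
Lemma step_repeat r s t : 4 <= r -> step r s t t -> step r t t t.
Proof.
case: s t => [[sa sb] sc] [[a b] c]; rewrite /step /=; lia.
Qed.

(** Far from the end all constraints are those at distance 4, so the prefixes of
    six states form one finite list, independent of the length of the word. *)
Lemma repetition_at_four u0 u1 u2 u3 u4 u5 w : 4 <= size w ->
  admissible 0 phantom start [:: u0, u1, u2, u3, u4, u5 & w] -> u4 = u5.
Proof.
move=> ge4 adw.
have: [:: u0; u1; u2; u3; u4; u5] \in completions 4 6 phantom start.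
  rewrite mem_completions eqxx /=; move: adw => /=.
  case/and5P=> st0 st1 st2 st3 /and3P[st4 st5 _].
  by apply/and5P; split; last (apply/and3P; split=> //);
     (apply: step_far; last eassumption); clear -ge4; lia.
have: all (fun w => nth start w 4 == nth start w 5) (completions 4 6 phantom start).
  by vm_compute.
by move/allP => E /E /eqP.
Qed.

Definition lengthen (w : seq state) : seq state :=
  if w is [:: u0, u1, u2, u3, u4 & w'] then [:: u0, u1, u2, u3, u4, u4 & w'] else w.

Lemma admissible_weaken e s s' t w :
  s \in below s' -> admissible e s t w -> admissible e s' t w.
Proof. by case: w => //= u w lt /andP[/(step_weaken lt)-> ->]. Qed.

Lemma words_lengthen n (w : seq state) :
  10 <= n -> w \in words n -> lengthen w \in words n.+1.
Proof.
move=> ge10; rewrite !mem_words.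
case: w => [|u0 [|u1 [|u2 [|u3 [|u4 [|u5 w]]]]]]; 
  try by move=> /and3P[_ /eqP/= sz _]; lia.
move=> /and3P[u0a /eqP/= sz adw]; have ge4 : 4 <= size w by lia.
have u45 := repetition_at_four ge4 adw; subst u5.
apply/and3P; split; rewrite //= ?sz //; move: adw => /=.
case/and5P=> st0 st1 st2 st3 /and3P[st4 st5 adw].
have st6 : step (0 + (size w).+1) u4 u4 u4.
  by apply: (@step_repeat _ u3); [|apply: step_far st5]; clear -ge4 ge10; lia.
have st7 : step (0 + size w) u4 u4 u4 by apply: step_far st6; clear -ge4 ge10; lia.
apply/and5P; split; last (apply/and4P; split; try exact: adw);
  by (apply: step_far; last eassumption); clear -ge4 ge10; lia.
Qed.

(** Removing one of two equal states only relaxes the constraint of type (iv)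
    on the state that follows, since earlier states are larger. *)
Lemma words_shorten n (w : seq state) : 10 <= n -> w \in words n.+1 ->
  exists2 v, v \in words n & w = lengthen v.
Proof.
move=> ge10; rewrite !mem_words.
case: w => [|u0 [|u1 [|u2 [|u3 [|u4 [|u5 w]]]]]]; 
  try by move=> /and3P[_ /eqP/= sz _]; lia.
move=> /and3P[u0a /eqP/= sz adw]; have ge4 : 4 <= size w by lia.
have u45 := repetition_at_four ge4 adw; subst u5.
exists [:: u0, u1, u2, u3, u4 & w] => //.
rewrite mem_words; apply/and3P; split=> //=; first by rewrite -eqSS sz.
move: adw => /=.
case/and5P=> st0 st1 st2 st3 /and3P[st4 st5 adw].
apply/and5P; split; last (apply/andP; split);
  try (by (apply: step_far; last eassumption); clear -ge4 ge10; lia).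
by apply: admissible_weaken adw; apply: step_below st4.
Qed.

Lemma lengthen_inj n : 10 <= n -> {in words n &, injective lengthen}.
Proof.
move=> ge10 v w; rewrite !mem_words => /and3P[_ /eqP szv _] /and3P[_ /eqP szw _].
have ge5v : 5 <= size v by rewrite szv (leq_trans _ ge10).
have ge5w : 5 <= size w by rewrite szw (leq_trans _ ge10).
case: v ge5v {szv} => [|v0 [|v1 [|v2 [|v3 [|v4 v]]]]] //= _.
by case: w ge5w {szw} => [|w0 [|w1 [|w2 [|w3 [|w4 w]]]]] //= _ [-> -> -> -> -> _ ->].
Qed.

Lemma all_realizable_lengthen w :
  9 <= size w -> all_realizable w -> all_realizable (lengthen w).
Proof.
case: w => [|u0 [|u1 [|u2 [|u3 [|u4 w]]]]] //= ge4.
have rS r u : 4 <= r -> realizable r u -> realizable r.+1 u.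
  by case: u => [[a b] c]; rewrite /realizable; case: r => [|[|[|[|r]]]].
case/and5P=> r0 r1 r2 r3 /andP[r4 rw].
apply/and5P; split; last (apply/and3P; split=> //);
  by apply: rS => //; clear -ge4; lia.
Qed.

Lemma words_succ n : 10 <= n -> words n.+1 =i map lengthen (words n).
Proof.
move=> ge10 w; apply/idP/mapP => [/(words_shorten ge10)|] [v vin ->].
  by exists v.
exact: words_lengthen.
Qed.

Lemma size_words_succ n : 10 <= n -> size (words n.+1) = size (words n).
Proof.
move=> ge10; rewrite -[RHS](size_map lengthen); apply: perm_size.
apply: uniq_perm (words_succ ge10); first exact: words_uniq.
by rewrite (map_inj_in_uniq (lengthen_inj ge10)) words_uniq.
Qed.

Lemma all_realizable_words_succ n : 10 <= n ->
  all all_realizable (words n) -> all all_realizable (words n.+1).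
Proof.
move=> ge10 /allP IHn; rewrite (eq_all_r (words_succ ge10)) all_map.
apply/allP => w win; apply: all_realizable_lengthen; last exact: IHn.
by move: win; rewrite mem_words => /and3P[_ /eqP-> _]; apply: leq_trans ge10.
Qed.

(** The cases [n = 7, ..., 10] are enumerated, and [n = 11] starts the induction. *)
Lemma words_count n : 7 <= n ->
  size (words n) == 47 /\ all all_realizable (words n).
Proof.
have [small|] := leqP n 10.
  move=> ge7; have: n \in [:: 7; 8; 9; 10] by rewrite !inE; lia.
  by rewrite !inE => /or4P[] /eqP->; split; vm_compute.
move=> gt10 _; rewrite -(subnKC gt10); elim: (n - 11) => [|m [IHsize IHall]].
  by rewrite addn0; split; vm_compute.
have ge10 : 10 <= 11 + m by [].
rewrite addnS; split; last exact: all_realizable_words_succ ge10 IHall.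
rewrite (size_words_succ ge10); exact: IHsize.
Qed.

(** * Rank matrices and words *)

Section Entries.

Variable N : nat.
Implicit Type M : 'M[nat]_N.

Lemma entry_ord M (i j : 'I_N) : entry M i j = M i j.
Proof. by rewrite /entry !valK. Qed.

Lemma entry_out M u v : N <= maxn u v -> entry M u v = 0.
Proof.
rewrite leq_max /entry => /orP[le_u|le_v].
  by rewrite insubF // ltnNge le_u.
by rewrite [insub v]insubF ?ltnNge ?le_v //; case: insub.
Qed.

Lemma entry_inj M M' :
  (forall u v, u < N -> v < N -> entry M u v = entry M' u v) -> M = M'.
Proof. by move=> E; apply/matrixP => i j; rewrite -!entry_ord E. Qed.

Lemma entry_matrix (F : nat -> nat -> nat) u v :
  entry (\matrix_(i < N, j < N) F i j)%R u v = if (u < N) && (v < N) then F u v else 0.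
Proof.
case: ifP => [/andP[ltu ltv]|/negbT].
  by rewrite -[u]/(val (Ordinal ltu)) -[v]/(val (Ordinal ltv)) entry_ord mxE.
by rewrite negb_and -!leqNgt -leq_max; apply: entry_out.
Qed.

(** [N.-1 - v] is the distance of the entry [(u, v)] from the end of its
    diagonal. *)
Definition word_entry (w : seq state) u v : nat :=
  if u <= v then layer (nth (0, 0, 0) w (v - u)) (minn u (N.-1 - v)) else 0.

Definition word_matrix (w : seq state) : 'M[nat]_N :=
  (\matrix_(u < N, v < N) word_entry w u v)%R.

Lemma entry_word w u v : entry (word_matrix w) u v =
  if u <= v < N then layer (nth (0, 0, 0) w (v - u)) (minn u (N.-1 - v)) else 0.
Proof.
rewrite entry_matrix /word_entry; have [le_uv|_] := leqP u v; last by case: (_ && _).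
by have [ltv|] := ltnP v N; [rewrite (leq_ltn_trans le_uv) | rewrite andbF].
Qed.

End Entries.

Definition hilb k : seq nat := [:: 1; 3] ++ nseq k 5 ++ [:: 3; 1].

Lemma size_hilb k : size (hilb k) = k + 4.
Proof. by rewrite /hilb !size_cat size_nseq /=; lia. Qed.

(** [T] is itself the diagonal with state [start]. *)
Lemma nth_hilb k u : nth 0 (hilb k) u =
  if u <= k + 3 then layer start (minn u (k + 3 - u)) else 0.
Proof.
case: u => [|[|u]]; rewrite /hilb.
- by rewrite min0n.
- by rewrite /= ifT ?(minn_idPl _) //; lia.
rewrite nth_cat /= nth_cat size_nseq nth_nseq !subSS subn0.
have [ltu|leu] := ltnP u k.
  rewrite ifT; last by lia.
  by case E: (minn _ _) => [|[|m]] //; lia.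
have: u = k \/ u = k.+1 \/ k.+1 < u by lia.
case=> [->|[->|gtu]].
- rewrite subnn /= ifT; last by lia.
  by rewrite (_ : minn _ _ = 1) //; lia.
- rewrite subSnn /= ifT; last by lia.
  by rewrite (_ : minn _ _ = 0) //; lia.
rewrite ifF; last by lia.
by rewrite nth_default //=; lia.
Qed.

Lemma max_hilb k : 0 < k -> \max_(t <- hilb k) t = 5.
Proof.
move=> k0; rewrite /hilb !big_cat /= !big_cons !big_nil.
suff -> : \max_(t <- nseq k 5) t = 5 by [].
by rewrite big_nseq; case: k k0 => // k _; elim: k => //= k ->.
Qed.

Lemma hilb_max k u : 0 < k ->
  (nth 0 (hilb k) u == \max_(t <- hilb k) t) = (2 <= u <= k + 1).
Proof.
move=> k0; rewrite max_hilb // nth_hilb; have [le_u|gt_u] := leqP u (k + 3); last by lia.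
by case E: (minn _ _) => [|[|m]] /=; lia.
Qed.

Lemma admissibleP e s t w d : admissible e s t w <-> forall i, i < size w ->
  step (e + (size w - i.+1)) (nth d [:: s, t & w] i) (nth d (t :: w) i) (nth d w i).
Proof.
elim: w s t => [|u w IHw] s t //=; split=> [/andP[stu /IHw adw] [|i] lti|H].
- by rewrite subn1.
- exact: adw.
apply/andP; split; first by have := H 0 isT; rewrite subn1.
by apply/IHw => i lti; apply: (H i.+1).
Qed.

Lemma AG3_hilbert_facts (K : fieldType) r h : AG3_hilbert_function K r h ->
  [/\ h 0 = 1, forall d, d <= r -> h d = h (r - d) & forall d, r < d -> h d = 0].
Proof.
case=> I [AG Hh]; split; first exact: (@AG_hilbert0 K 2 I r AG h Hh).
  by move=> d; exact: (@AG_hilbert_symmetric K 2 I r AG h Hh d).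
by move=> d; exact: (@AG_hilbert_above K 2 I r AG h Hh d).
Qed.

Lemma AG3_O_sequence (K : fieldType) r h : AG3_hilbert_function K r h -> O_sequence K h.
Proof. by case=> I [AG Hh]; right; exists 2, I; split=> //; apply: AG_homogeneous AG. Qed.

Lemma O_sequence_growth (K : fieldType) h : O_sequence K h -> h 1 <= 2 ->
  forall d, h d <= d.+1 /\ (h d <= d -> h d.+1 <= h d).
Proof.
case=> [h0 _ d|[n [I [idI Hh]]] h1]; first by rewrite !h0.
exact: two_generated_growth idI Hh h1.
Qed.

Lemma AG3_ext (K : fieldType) r h h' :
  h =1 h' -> AG3_hilbert_function K r h -> AG3_hilbert_function K r h'.
Proof. by move=> hh' [I [AG Hh]]; exists I; split=> // d; rewrite -hh'. Qed.

(** * From a potential rank matrix to a word *)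

Section WordOfMatrix.

Variables (K : fieldType) (k : nat) (k_ge4 : 4 <= k).
Variable M : 'M[nat]_(size (hilb k)).
Hypothesis prmM : potential_rank_matrix K M.

Let j := k + 3.
Let e := entry M.
Let sizeT : size (hilb k) = j.+1. Proof. by rewrite size_hilb; lia. Qed.

Lemma diagE i u : diagonal M i u = e u (u + i). Proof. by []. Qed.

Lemma entry_upper u v : v < u -> e u v = 0.
Proof.
move=> lt_vu; have [ltu|leu] := ltnP u (size (hilb k)); last first.
  by apply: entry_out; rewrite leq_max leu.
have ltv := ltn_trans lt_vu ltu.
rewrite /e -[u]/(val (Ordinal ltu)) -[v]/(val (Ordinal ltv)) entry_ord.
by rewrite (prm_upper prmM).
Qed.

Lemma entry_diag u : u <= j -> e u u = layer start (minn u (j - u)).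
Proof.
move=> leu; have := prm_diag0 prmM u; rewrite diagE addn0 => ->.
by rewrite nth_hilb leu.
Qed.

Lemma diag_cases i : i <= j ->
  (forall u, e u (u + i) = 0) \/
  (e 0 i = 1 /\ forall u, u + i <= j -> e u (u + i) = e (j - i - u) (j - u)).
Proof.
move=> lei; have [|zero|AG] := prm_AG prmM (i := i); first by rewrite sizeT.
  by left.
right; have [h0 symm _] := AG3_hilbert_facts AG.
split; first by rewrite -h0 diagE add0n.
move=> u leu; have := symm u; rewrite !diagE sizeT /= => ->; last by lia.
by congr (e _ _); lia.
Qed.

(** Duality on the diagonal through [(u, v)] is reflection of the matrix in its
    antidiagonal. *)
Lemma entry_sym u v : u <= v <= j -> e u v = e (j - v) (j - u).
Proof.
case/andP=> le_uv le_vj; have [|zero|[_ symm]] := @diag_cases (v - u); first lia.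
  have := zero u; have := zero (j - v).
  by rewrite (_ : j - v + (v - u) = j - u) 1?(_ : u + (v - u) = v); try lia.
have := symm u; rewrite (_ : u + (v - u) = v) //; try lia.
by move=> -> //; congr (e _ _); lia.
Qed.

Lemma corner_cases i : i <= j ->
  (e 0 i = 0 /\ forall u, e u (u + i) = 0) \/ e 0 i = 1.
Proof.
by case/diag_cases=> [zero|[-> _]]; [left; split=> //; apply: (zero 0) | right].
Qed.

Lemma entry_plateau u v : 2 <= u <= v -> v <= k + 1 -> e u v = e 2 (v - u + 2).
Proof.
move=> /andP[geu le_uv] le_v.
have top w : 2 <= w <= k + 1 -> nth 0 (hilb k) w = \max_(t <- hilb k) t.
  by move=> w_in; apply/eqP; rewrite hilb_max //; lia.
by apply: (prm_plateau prmM); rewrite ?sizeT ?top //; lia.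
Qed.

Definition matrix_word : seq state :=
  mkseq (fun i => (e 0 i, if i + 2 <= j then e 1 i.+1 else 0,
                   if i + 4 <= j then e 2 i.+2 else 0)) j.+1.

Lemma nth_matrix_word i : i <= j -> nth (0, 0, 0) matrix_word i =
  (e 0 i, if i + 2 <= j then e 1 i.+1 else 0, if i + 4 <= j then e 2 i.+2 else 0).
Proof. by move=> lei; rewrite nth_mkseq. Qed.

Lemma matrix_of_word : M = word_matrix (size (hilb k)) matrix_word.
Proof.
apply: entry_inj => u v ltu ltv; rewrite entry_word ltv andbT.
have {ltu ltv}lev : v <= j by rewrite -ltnS -sizeT.
have -> : (size (hilb k)).-1 = j by rewrite sizeT.
have [le_uv|] := leqP u v; last exact: entry_upper.
rewrite nth_matrix_word; last by lia.
have symm := @entry_sym u v; rewrite le_uv lev in symm.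
case E: (minn u (j - v)) => [|[|m]] /=.
- have [u0|jv] : u = 0 \/ j - v = 0 by lia.
    by rewrite u0 subn0.
  by rewrite -/e symm // jv; congr (e _ _); lia.
- rewrite ifT; last by lia.
  have [u0|jv] : u = 1 \/ j - v = 1 by lia.
    by rewrite u0; congr (entry _ _ _); lia.
  by rewrite -/e symm // jv; congr (e _ _); lia.
rewrite ifT; last by lia.
by rewrite -/e entry_plateau; [congr (e _ _) | |]; lia.
Qed.

Lemma entry_rows u v : u <= v -> v < j -> e u v.+1 <= e u v.
Proof. by move=> le_uv lt_v; apply: (prm_rows prmM); rewrite ?sizeT. Qed.

Lemma entry_cols u v : u < v -> v <= j -> e u v <= e u.+1 v.
Proof. by move=> lt_uv le_v; apply: (prm_cols prmM); rewrite ?sizeT. Qed.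

Lemma entry_exchange u v : u < v -> v < j -> e u v + e u.+1 v.+1 <= e u.+1 v + e u v.+1.
Proof. by move=> lt_uv lt_v; apply: (prm_exchange prmM); rewrite ?sizeT. Qed.

Lemma entry1_le i : i + 2 <= j -> e 1 i.+1 <= 3.
Proof.
elim: i => [|i IHi] lei.
  by rewrite entry_diag ?(minn_idPl _) //; lia.
by apply: leq_trans (IHi _); [apply: entry_rows | ]; lia.
Qed.

Lemma diagonal_growth i : i <= j -> exists h,
  [/\ h 0 = e 0 i, forall u, e u.+1 (u.+1 + i) = e u (u.+1 + i) + h u.+1
    & h 1 <= 2 -> forall d, h d <= d.+1 /\ (h d <= d -> h d.+1 <= h d)].
Proof.
move=> lei; have [|h Oh hE] := prm_Oseq prmM (i := i); first by rewrite sizeT.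
exists h; split; last exact: O_sequence_growth Oh.
  by have := hE 0; rewrite diagE add0n /=; lia.
move=> u; have := hE u.+1; rewrite /= !diagE addnS -addSn; lia.
Qed.

(** The O-sequence of (ii) is compared in degrees 1, 2, 3 and in the two degrees
    before its top degree [j - i], where the diagonal leaves its plateau. *)
Lemma matrix_word_growth i : i < j ->
  growth_ok (j - i.+1) (nth (0, 0, 0) matrix_word i) (nth (0, 0, 0) matrix_word i.+1).
Proof.
move=> lt_ij; rewrite !nth_matrix_word //; last exact: ltnW.
have [h [h0 hS grow]] := diagonal_growth (ltnW lt_ij).
have b3 : i + 2 <= j -> e 1 i.+1 <= 3 := @entry1_le i.
have S1 := hS 0; have S2 := hS 1; have S3 := hS 2.
rewrite !addSn add0n in S1 S2 S3.
(* the two entries of the difference next to the top degree, read by symmetry *)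
have last2 : i + 2 <= j -> e 1 i.+1 = e (j - i - 2) j.-1 + h (j - i - 1).
  move=> le2; have := hS (j - i - 2).
  rewrite (_ : (j - i - 2).+1 = j - i - 1) 1?(_ : _ + i = j.-1); try lia.
  by rewrite (@entry_sym _ j.-1); [move=> <-; congr (e _ _) |]; lia.
have last3 : i + 4 <= j -> e 2 i.+2 = e (j - i - 3) (j - 2) + h (j - i - 2).
  move=> le4; have := hS (j - i - 3).
  rewrite (_ : (j - i - 3).+1 = j - i - 2) 1?(_ : _ + i = j - 2); try lia.
  by rewrite (@entry_plateau (j - i - 2)); [move=> <-; congr (e _ _) | |]; lia.
have [[a0 zero]|a1] := @corner_cases i.+1 lt_ij; last first.
  rewrite /growth_ok a1 /=; have [ge3|lt3] /= := ltnP 2 (j - i.+1); last first.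
    by rewrite ltnNge ltnW.
  have -> : i + 2 <= j by lia.
  have -> : i + 4 <= j by lia.
  have -> : i.+1 + 2 <= j by lia.
  have h1 : h 1 <= 2 by have := b3; lia.
  have [_ g1] := grow h1 1; have [b2 g2] := grow h1 2.
  apply/andP; split; first by lia.
  apply/implyP => ge4; have -> : i.+1 + 4 <= j by lia.
  have cE : e 3 i.+3 = e 2 i.+2.
    by rewrite entry_plateau; [congr (e _ _) | |]; lia.
  have b'E : e (j - i - 2) j.-1 = e 1 i.+2.
    by rewrite entry_sym; [congr (e _ _) |]; lia.
  have c'E : e (j - i - 3) (j - 2) = e 2 i.+3.
    by rewrite entry_plateau; [congr (e _ _) | |]; lia.
  have [g3 _] := grow h1 3; have [_ gl] := grow h1 (j - i - 2).
  rewrite (_ : (j - i - 2).+1 = j - i - 1) in gl; last by lia.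
  lia.
rewrite /growth_ok a0 /=; apply/implyP => /andP[/eqP A1 B2].
apply/andP; split; apply/implyP => ge.
all: have le2 : i + 2 <= j by lia.
all: rewrite le2 in B2 *.
all: have h1 : h 1 <= 2 by lia.
all: have Z2 := zero (j - i - 2); rewrite (_ : _ + i.+1 = j.-1) in Z2; last lia.
- have Z1 := zero (j - i - 1); rewrite (_ : _ + i.+1 = j) in Z1; last lia.
  have top := hS (j - i - 1); rewrite (_ : _.+1 + i = j) in top; last lia.
  rewrite Z1 (@entry_sym _ j) in top; last lia.
  rewrite subnn (_ : j - _ = i) in top; last lia.
  have [_] := grow h1 (j - i - 1); have := last2 le2; lia.
have -> : i + 4 <= j by lia.
have Z3 := zero (j - i - 3); rewrite (_ : _ + i.+1 = j - 2) in Z3; last lia.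
have [_] := grow h1 (j - i - 2); rewrite (_ : (j - i - 2).+1 = j - i - 1); last lia.
have := last2 le2; have := last3; lia.
Qed.

(** At [i = 0] the constraints of type (iv) hold by the size of [phantom]. *)
Lemma matrix_word_step i : i < j ->
  step (j - i.+1) (if i is i'.+1 then nth (0, 0, 0) matrix_word i' else phantom)
       (nth (0, 0, 0) matrix_word i) (nth (0, 0, 0) matrix_word i.+1).
Proof.
move=> lt_ij; have := matrix_word_growth lt_ij.
rewrite !nth_matrix_word ?(ltnW lt_ij) //; set s := (X in step _ X _ _) => growth.
have: [/\ i + 2 <= j -> e 0 i + e 1 i.+1 <= s.1.2 + e 0 i.+1,
    i + 4 <= j -> e 1 i.+1 + e 2 i.+2 <= s.2 + e 1 i.+2,
    i + 5 <= j -> 2 * e 2 i.+2 <= s.2 + e 2 i.+3,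
    i.+1 = j -> 2 * e 0 i <= s.1.2 + e 0 i.+1
  & i + 3 = j -> 2 * e 1 i.+1 <= s.2 + e 1 i.+2].
  rewrite /s; case: (i) lt_ij => [|i'] lt_ij'.
    rewrite !entry_diag; try lia.
    by rewrite /= min0n !(minn_idPl _) /=; try lia; split; lia.
  rewrite nth_matrix_word ?(ltnW (ltnW lt_ij')) //=.
  have X0 : e 0 i'.+1 + e 1 i'.+2 <= e 1 i'.+1 + e 0 i'.+2 by apply: entry_exchange.
  have X1 : i' + 3 <= j -> e 1 i'.+2 + e 2 i'.+3 <= e 2 i'.+2 + e 1 i'.+3.
    by move=> ?; apply: entry_exchange; lia.
  have X2 : i' + 5 <= j -> e 2 i'.+3 + e 3 i'.+4 <= e 3 i'.+3 + e 2 i'.+4.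
    by move=> ?; apply: entry_exchange; lia.
  split=> lei.
  - by rewrite ifT; lia.
  - by rewrite ifT; lia.
  - rewrite ifT; last by lia.
    rewrite (@entry_plateau 3 i'.+3) ?(@entry_plateau 3 i'.+4) in X2; try lia.
    move: X2; rewrite ?subSS ?subn0 !addn2; lia.
  - rewrite ifT; last by lia.
    have -> : 2 * e 0 i'.+1 = e 0 i'.+1 + e 1 i'.+2; last exact: X0.
    by rewrite (@entry_sym 1); [rewrite mul2n -addnn; congr (_ + e _ _)|]; lia.
  rewrite ifT; last by lia.
  have -> : 2 * e 1 i'.+2 = e 1 i'.+2 + e 2 i'.+3; last by apply: X1; lia.
  by rewrite (@entry_sym 2); [rewrite mul2n -addnn; congr (_ + e _ _)|]; lia.
case: s => [[sa sb] sc] /= [X0 X1 X2 Y0 Y1].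
rewrite /step growth andbT.
have row0 : e 0 i.+1 <= e 0 i by apply: entry_rows.
have row1 : i + 3 <= j -> e 1 i.+2 <= e 1 i.+1 by move=> ?; apply: entry_rows; lia.
have row2 : i + 5 <= j -> e 2 i.+3 <= e 2 i.+2 by move=> ?; apply: entry_rows; lia.
have col0 : i + 2 <= j -> e 0 i.+1 <= e 1 i.+1 by move=> ?; apply: entry_cols; lia.
have col1 : i + 4 <= j -> e 1 i.+2 <= e 2 i.+2 by move=> ?; apply: entry_cols; lia.
have corner : (e 0 i.+1 = 0 /\ e 1 i.+2 = 0 /\ e 2 i.+3 = 0) \/ e 0 i.+1 = 1.
  have [[a0 zero]|] := corner_cases lt_ij; [left | by right].
  by have := zero 1; have := zero 2; rewrite !addSn !add0n.
clear growth prmM; case: (leqP (i + 2) j) => ?; case: (leqP (i + 4) j) => ?;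
  case: (leqP (i.+1 + 2) j) => ?; case: (leqP (i.+1 + 4) j) => ?; try lia.
Qed.

Lemma matrix_word_words : exists2 w, w \in words j &
  M = word_matrix (size (hilb k)) (start :: w).
Proof.
have W0 : nth (0, 0, 0) matrix_word 0 = start.
  rewrite nth_matrix_word // !ifT; try lia.
  by rewrite !entry_diag ?min0n ?(minn_idPl _) //; lia.
exists (behead matrix_word); last first.
  by rewrite -W0 [LHS]matrix_of_word.
have WE : start :: behead matrix_word = matrix_word by rewrite -W0.
have sizeW : size (behead matrix_word) = j by rewrite size_behead size_mkseq.
rewrite mem_words sizeW eqxx; apply/and3P; split=> //.
  rewrite -nth0 (set_nth_default (0, 0, 0)) ?sizeW ?nth_behead; last by lia.
  rewrite nth_matrix_word /=; last by lia.
  have j1 : 1 <= j by lia.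
  have [[_ zero]|->] // := corner_cases j1.
  by have [u] := prm_diag1 prmM; rewrite diagE zero.
apply/(admissibleP _ _ _ _ (0, 0, 0)) => i; rewrite sizeW WE add0n => lt_ij.
have := matrix_word_step lt_ij; rewrite -nth_behead.
by case: i lt_ij.
Qed.

End WordOfMatrix.

(** * From a word to a potential rank matrix *)

Lemma all_realizable_nth w d i : all_realizable w -> i < size w ->
  realizable (size w - i.+1) (nth d w i).
Proof.
elim: w i => [|u w IHw] [|i] //= /andP[ru rw] lti; first by rewrite subn1.
exact: IHw.
Qed.

Section MatrixOfWord.

Variables (K : fieldType) (k : nat) (k_ge4 : 4 <= k) (w : seq state).
Let j := k + 3.
Hypotheses (w_word : w \in words j) (w_real : all_realizable w).

Let S i := nth (0, 0, 0) (start :: w) i.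
Let M := word_matrix (size (hilb k)) (start :: w).
Let e := entry M.
Let sizeT : size (hilb k) = j.+1. Proof. by rewrite size_hilb; lia. Qed.
Let size_w : size w = j.
Proof. by have := w_word; rewrite mem_words => /and3P[_ /eqP]. Qed.

Lemma word_entryE u v :
  e u v = if u <= v <= j then layer (S (v - u)) (minn u (j - v)) else 0.
Proof.
rewrite /e entry_word -[v <= j]ltnS -sizeT; case: ifP => // _.
by rewrite -[in RHS](succnK j) -sizeT.
Qed.

Lemma word_step i : i < j ->
  step (j - i.+1) (if i is i'.+1 then S i' else phantom) (S i) (S i.+1).
Proof.
move=> lt_ij; have := w_word; rewrite mem_words => /and3P[_ _].
move/(admissibleP _ _ _ _ (0, 0, 0)) => /(_ i); rewrite size_w add0n => /(_ lt_ij).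
by case: i lt_ij.
Qed.

Lemma word_realizable i : i <= j -> realizable (j - i) (S i).
Proof.
case: i => [|i] lei; first by rewrite subn0 /realizable /= !ifF //; lia.
by rewrite -size_w; apply: all_realizable_nth => //; rewrite size_w.
Qed.

Lemma layer_row i m : i < j -> layer (S i.+1) m <= layer (S i) m.
Proof.
move/word_step; case: (S i) (S i.+1) (if i is _.+1 then _ else _)
  => [[A B] C] [[a b] c] [[? ?] ?].
by case/and5P=> _ /and3P[? ? ?] *; case: m => [|[|m]].
Qed.

Lemma layer_col i m : i < j -> m.*2.+2 <= j - i -> layer (S i.+1) m <= layer (S i) m.+1.
Proof.
move=> ltij; have := word_step ltij; rewrite subnS.
case: (S i) (S i.+1) (if i is _.+1 then _ else _) => [[A B] C] [[a b] c] [[? ?] ?].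
case/and5P=> _ /and3P[? ? ?] s1 s2 _; case: m => [|[|m]] /= ger //.
  by have := s1; lia.
by have := s2; lia.
Qed.

(** Condition (iv) off the middle of the diagonal. *)
Lemma layer_exchange i m : i.+1 < j -> m.*2.+2 <= j - i.+1 ->
  layer (S i.+1) m + layer (S i.+1) m.+1 <= layer (S i) m.+1 + layer (S i.+2) m.
Proof.
move=> ltij; have := word_step ltij; rewrite subnS.
case: (S i) (S i.+1) (S i.+2) => [[sa sb] sc] [[A B] C] [[a b] c].
case/and5P=> _ _ s1 s2 /andP[/and3P[s3 _ _] _]; case: m => [|[|m]] /= ger.
- lia.
- lia.
- have : 3 < (j - i.+1).-1 by lia.
  by move/(implyP s3); rewrite mul2n -addnn.
Qed.

(** Condition (iv) at the middle of a diagonal with an even number of entries. *)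
Lemma layer_exchange_mid i m : i.+1 < j -> m.*2.+1 = j - i.+1 ->
  (layer (S i.+1) m).*2 <= layer (S i) m.+1 + layer (S i.+2) m.
Proof.
move=> ltij; have := word_step ltij; rewrite subnS.
case: (S i) (S i.+1) (S i.+2) => [[sa sb] sc] [[A B] C] [[a b] c].
case/and5P=> _ _ _ _ /andP[/and3P[s3 s4 s5] _]; case: m => [|[|m]] /= rE; rewrite -mul2n.
- by apply: (implyP s4); apply/eqP; lia.
- by apply: (implyP s5); apply/eqP; lia.
by apply: (implyP s3); lia.
Qed.

Lemma word_rows u v : u <= v -> v < j -> e u v.+1 <= e u v.
Proof.
move=> le_uv lt_vj; rewrite !word_entryE !ifT; try lia.
rewrite subSn //; have [le|gt] := leqP u (j - v.+1).
  rewrite !(minn_idPl _); try lia.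
  by apply: layer_row; lia.
rewrite !(minn_idPr _); try lia.
rewrite (_ : j - v = (j - v.+1).+1); last by lia.
by apply: layer_col; lia.
Qed.

Lemma word_cols u v : u < v -> v <= j -> e u v <= e u.+1 v.
Proof.
move=> lt_uv le_vj; rewrite !word_entryE !ifT; try lia.
rewrite (_ : v - u = (v - u.+1).+1); last by lia.
have [le|gt] := leqP (j - v) u.
  rewrite !(minn_idPr _); try lia.
  by apply: layer_row; lia.
rewrite !(minn_idPl _); try lia.
by apply: layer_col; lia.
Qed.

Lemma word_exchange u v : u < v -> v < j ->
  e u v + e u.+1 v.+1 <= e u.+1 v + e u v.+1.
Proof.
move=> lt_uv lt_vj; rewrite !word_entryE !ifT; try lia.
have [i iE] : exists i, v - u = i.+1 by exists (v - u).-1; lia.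
rewrite subSS iE (_ : v - u.+1 = i) 1?(_ : v.+1 - u = i.+2); try lia.
have [le|gt] := leqP (j - v) u.
  have [m mE] : exists m, j - v = m.+1 by exists (j - v).-1; lia.
  rewrite mE (_ : minn u.+1 (j - v.+1) = m); last by lia.
  rewrite (_ : minn u.+1 m.+1 = m.+1) 1?(_ : minn u (j - v.+1) = m); try lia.
  by rewrite addnC; apply: layer_exchange; lia.
have [jv|gt'] : j - v = u.+1 \/ u.+1 < j - v by lia.
  rewrite (_ : minn u.+1 (j - v.+1) = u); last by lia.
  rewrite (_ : minn u.+1 (j - v) = u.+1) 1?(_ : minn u (j - v.+1) = u); try lia.
  by rewrite addnn; apply: layer_exchange_mid; lia.
rewrite (_ : minn u.+1 (j - v.+1) = u.+1); last by lia.
rewrite (_ : minn u.+1 (j - v) = u.+1) 1?(_ : minn u (j - v.+1) = u); try lia.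
by apply: layer_exchange; lia.
Qed.

Lemma word_diagonal i u : diagonal M i u =
  if u <= j - i then (if i <= j then layer (S i) (minn u (j - i - u)) else 0) else 0.
Proof.
rewrite /diagonal -/e word_entryE leq_addr addKn /=.
have [le|gt] := leqP (u + i) j; last by case: ifP => // ?; rewrite ifF //; lia.
by rewrite !ifT; try lia; congr (layer _ (minn _ _)); lia.
Qed.

Lemma word_corner i : i <= j -> (S i).1.1 <= 1.
Proof.
case: i => [|i] // ltij; have := word_step ltij.
case: (S i) (S i.+1) (if i is _.+1 then _ else _) => [[A B] C] [[a b] c] [[? ?] ?].
by case/andP=> /and4P[].
Qed.

Lemma word_AG i : i <= j ->
  ((S i).1.1 = 0 /\ forall u, diagonal M i u = 0) \/
  ((S i).1.1 = 1 /\ AG3_hilbert_function K (j - i) (diagonal M i)).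
Proof.
move=> le_ij; have := word_realizable le_ij; have := word_corner le_ij.
have dE u := word_diagonal i u; rewrite le_ij in dE.
move: dE; case: (S i) => [[[|[|a]] b] c] //= dE _.
  case/andP=> /eqP b0 /eqP c0; left; split=> // u; rewrite dE b0 c0.
  by case: ifP => // _; case: (minn _ _) => [|[|m]].
move=> real; right; split=> //.
pose b' := if j - i < 2 then 1 else b; pose c' := if j - i < 4 then b' else c.
have bc : (b', c') \in realizable_pairs.
  rewrite /c' /b'; move: real; have [lt2|ge2] := ltnP (j - i) 2.
    by rewrite (leq_trans lt2).
  have [lt4|ge4] // := ltnP (j - i) 4.
  by case: (b) => [|[|[|[|?]]]].
apply: (@AG3_ext K _ (profile b' c' (j - i))); last first.
  by apply: profile_gorenstein => //; rewrite /c' /b' => ->.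
move=> u; rewrite /profile dE; case: leqP => // le_u.
rewrite /c' /b'; case E: (minn _ _) => [|[|m]] //=.
  by have -> : (j - i < 2) = false by lia.
rewrite nth_nil; have -> : (j - i < 4) = false by lia.
by [].
Qed.

(** If the next diagonal vanishes, the difference is the Hilbert function of a
    Gorenstein algebra; otherwise it has at most two in degree one, and Macaulay's
    bound is sufficient. *)
Lemma word_O_sequence i : i <= j -> exists2 h, O_sequence K h &
  forall u, ((diagonal M i u)%:Z - (shift (diagonal M i.+1) u)%:Z = (h u)%:Z)%R.
Proof.
move=> le_ij.
have [last|a'1] : (forall u, diagonal M i.+1 u = 0) \/ (i < j /\ (S i.+1).1.1 = 1).
  have [lt_ij|le_ji] := ltnP i j; last first.
    by left=> u; rewrite word_diagonal; case: ifP => // _; rewrite ifF //; lia.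
  by case: (word_AG lt_ij) => [[_ zero]|[a1 _]]; [left | right].
  exists (diagonal M i); last first.
    by move=> [|u] /=; rewrite ?last subr0.
  case: (word_AG le_ij) => [[_ zero]|[_ /AG3_O_sequence //]].
  by left.
case: a'1 => lt_ij a'1.
have lower u : shift (diagonal M i.+1) u <= diagonal M i u.
  case: u => //= u; have := @word_cols u (u + i.+1).
  rewrite /diagonal -/e addSnnS.
  have [le|gt] := leqP (u + i.+1) j; first by apply => //; lia.
  by move=> _; rewrite word_entryE ifF //; lia.
exists (fun u => diagonal M i u - shift (diagonal M i.+1) u); last first.
  by move=> u; rewrite subzn.
have hE u : diagonal M i u - shift (diagonal M i.+1) u =
    if u is u'.+1 then
      if u <= j - i then
        layer (S i) (minn u (j - i - u)) - layer (S i.+1) (minn u' (j - i - u)) else 0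
    else (S i).1.1.
  case: u => [|u] /=; first by rewrite word_diagonal le_ij min0n subn0.
  rewrite !word_diagonal le_ij lt_ij; have [le|gt] := leqP u.+1 (j - i).
    rewrite ifT; last by lia.
    by rewrite (_ : j - i.+1 - u = j - i - u.+1) //; lia.
  by rewrite ifF //; lia.
have := word_step lt_ij; have := word_realizable le_ij; have := word_realizable lt_ij.
have := word_corner le_ij; rewrite subnS; set R := j - i in hE *.
have R1 : 0 < R by rewrite subn_gt0.
move: hE a'1; case: (S i) (S i.+1) (if i is _.+1 then _ else _)
  => [[A B] C] [[a b] c] [[? ?] ?].
move=> hE /= a1 A1 real' real st; rewrite {}a1 in hE real' st.
have A_1 : A = 1 by case/and5P: st => _ /and3P[/= ? _ _] *; apply/eqP; rewrite eqn_leq A1.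
rewrite {}A_1 {A1} in hE real st.
pose g d := if d == 0 then 1 else if R <= d then 0 else if d == 1 then B - 1
  else if d.+1 == R then B - b else if d == 2 then C - b else C - c.
have gE d : diagonal M i d - shift (diagonal M i.+1) d = g d.
  rewrite hE /g; case: d => [|d] //=; rewrite [d.+1 == 1]eqSS.
  have [ltR|] := ltnP d.+1 R; last first.
    rewrite leq_eqVlt => /orP[/eqP RE|gtR]; last by rewrite leqNgt gtR.
    by rewrite RE leqnn subnn !minn0.
  rewrite ltnW //; case: eqP => [->|d0].
    by rewrite min0n (minn_idPl _) //=; lia.
  case: eqP => [RE|dR].
    by rewrite -RE subSnn !(minn_idPr _) //=; lia.
  case: eqP => [d1|d1].
    rewrite (_ : minn d.+1 _ = 2) 1?(_ : minn d _ = 1) //; lia.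
  have [m mE] : exists m, minn d.+1 (R - d.+1) = m.+2.
    by exists (minn d.+1 (R - d.+1) - 2); lia.
  have [m' m'E] : exists m', minn d (R - d.+1) = m'.+2.
    by exists (minn d (R - d.+1) - 2); lia.
  by rewrite mE m'E.
have b_range : 2 < R -> 0 < b <= 3.
  move: real'; rewrite /realizable /=; case: ifP => [|_]; first by lia.
  by case: ifP => // _ /realizable_bounds[].
have B_range : 1 < R -> 0 < B <= 3.
  move: real; rewrite /realizable /=; case: ifP => [|_]; first by lia.
  by case: ifP => // _ /realizable_bounds[].
have C_range : 3 < R -> B <= C.
  move: real; rewrite /realizable /=; case: ifP => [|_]; first by lia.
  by case: ifP => [|_ /realizable_bounds[_ /andP[]]] //; lia.
have stb : [/\ b <= B, c <= C & growth_ok R.-1 (1, B, C) (1, b, c)].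
  by case/and5P: st => _ /and3P[_ bB cC] _ _ /andP[_ gr]; split.
case: stb => bB cC; rewrite /growth_ok /= => gr.
have gr1 : 3 < R -> (B <= 2 -> C < B + b) /\ C <= b + 3 by move=> ?; split=> *; lia.
have gr2 : 4 < R -> (C <= b + 2 -> b <= c) /\ C <= c + 4 /\ B + c <= C + b.
  by move=> ?; split; [|split]; lia.
have bound d : g d <= d.+1.
  rewrite /g; clear -b_range B_range C_range bB cC gr1 gr2.
  by (repeat case: ifP) => *; lia.
have growth d : g d <= d -> g d.+1 <= g d.
  rewrite /g; clear -b_range B_range C_range bB cC gr1 gr2 R1.
  by (repeat case: ifP) => *; lia.
apply: O_sequence_of_growth => d; rewrite !gE //; exact: growth.
Qed.

Lemma word_potential : potential_rank_matrix K M.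
Proof.
split.
- move=> u v ltvu; rewrite -entry_ord -/e word_entryE ifF //; lia.
- move=> u; rewrite word_diagonal nth_hilb subn0 leq0n.
  by case: ifP.
- exists 0; rewrite word_diagonal leq0n min0n ifT; last by lia.
  have := w_word; rewrite mem_words => /and3P[/eqP + _ _].
  by rewrite /S /= -nth0 (set_nth_default (0, 0, 0)) ?size_w => [->|] //; lia.
- have -> : (size (hilb k)).-1 = j by rewrite sizeT.
  move=> i; rewrite [X in _ < X]sizeT ltnS => /word_AG.
  by case=> [[_ zero]|[_ AG]]; [left | right].
- by move=> i; rewrite [X in _ < X]sizeT ltnS; apply: word_O_sequence.
- by move=> u v le_uv; rewrite [X in _ < X]sizeT ltnS; apply: word_rows.
- by move=> u v lt_uv; rewrite [X in _ < X]sizeT ltnS; apply: word_cols.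
- have -> : (size (hilb k)).-1 = j by rewrite sizeT.
  exact: word_exchange.
move=> u v u' v' le_uv _ le_uv' _ /eqP + /eqP + /eqP + /eqP.
rewrite !hilb_max; try lia; move=> u_in v_in u'_in v'_in vE.
rewrite -/e !word_entryE !ifT -?vE; try lia.
have [m mE] : exists m, minn u (j - v) = m.+2.
  by exists (minn u (j - v) - 2); lia.
have [m' m'E] : exists m', minn u' (j - v') = m'.+2.
  by exists (minn u' (j - v') - 2); lia.
by rewrite mE m'E.
Qed.

Lemma word_stateE i : i <= j ->
  S i = (e 0 i, if i + 2 <= j then e 1 i.+1 else 0, if i + 4 <= j then e 2 i.+2 else 0).
Proof.
move=> le_ij; have e0 : e 0 i = (S i).1.1.
  by rewrite word_entryE leq0n le_ij min0n subn0.
have e1 : i + 2 <= j -> e 1 i.+1 = (S i).1.2.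
  move=> le2; rewrite word_entryE ifT; last by lia.
  by rewrite subSS subn0 (minn_idPl _) //; lia.
have e2 : i + 4 <= j -> e 2 i.+2 = (S i).2.
  move=> le4; rewrite word_entryE ifT; last by lia.
  by rewrite !subSS subn0 (minn_idPl _) //; lia.
have zero : (j - i < 2 -> (S i).1.2 = 0) /\ (j - i < 4 -> (S i).2 = 0).
  case: (i) le_ij => [|i1] ltij; first by lia.
  have := word_step ltij.
  case: (S i1) (S i1.+1) (if i1 is _.+1 then _ else _) => [[A B] C] [[a b] c] [[? ?] ?].
  by case/andP=> /and4P[_ _ /implyP b0 /implyP c0] _; split=> [/b0|/c0] /eqP.
case: zero => b0 c0; rewrite e0 [LHS]surjective_pairing [(S i).1]surjective_pairing.
congr (_, _, _); case: leqP => [le|gt]; rewrite ?e1 ?e2 //.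
  by apply: b0; lia.
by apply: c0; lia.
Qed.

End MatrixOfWord.

Lemma words_realizable k w : 4 <= k -> w \in words (k + 3) -> all_realizable w.
Proof.
move=> k4; have [_ /allP real] : _ := @words_count (k + 3) (leq_add k4 (leqnn 3)).
exact: real.
Qed.

Lemma word_matrix_inj k : 4 <= k ->
  {in words (k + 3) &, injective (fun w => word_matrix (size (hilb k)) (start :: w))}.
Proof.
move=> k4 w w' win w'in eqM.
have sz v : v \in words (k + 3) -> size v = k + 3.
  by rewrite mem_words => /and3P[_ /eqP].
apply: (@eq_from_nth _ (0, 0, 0)) => [|i]; first by rewrite !sz.
rewrite sz // => lti.
have := word_stateE k4 win (words_realizable k4 win) (i := i.+1) lti.
have := word_stateE k4 w'in (words_realizable k4 w'in) (i := i.+1) lti.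
by rewrite /= eqM => -> ->.
Qed.


(** * Jordan degree types *)

Section JordanType.

Variable N : nat.
Implicit Types (M : 'M[nat]_N) (S : {mset (nat * nat)}).

(** The defining relation expresses the entry [(u, v)] through entries closer to
    the corner [(0, N - 1)]; below the diagonal both matrices vanish. *)
Lemma jordan_type_inj M M' S :
    (forall u v : 'I_N, v < u -> M u v = 0) ->
    (forall u v : 'I_N, v < u -> M' u v = 0) ->
  jordan_degree_type_of M S -> jordan_degree_type_of M' S -> M = M'.
Proof.
move=> upM upM' [SM _] [SM' _].
suff eqE n u v : u <= v -> u + (N - v) < n -> entry M u v = entry M' u v.
  apply: entry_inj => u v ltu ltv; have [le_uv|lt_vu] := leqP u v.
    by apply: (eqE (u + (N - v)).+1).
  rewrite -[u]/(val (Ordinal ltu)) -[v]/(val (Ordinal ltv)) !entry_ord.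
  by rewrite upM ?upM'.
elim: n u v => // n IHn u v le_uv le_n.
have [le_Nv|ltv] := leqP N v.
  by rewrite !entry_out // leq_max le_Nv orbT.
have right_eq : entry M u v.+1 = entry M' u v.+1 by apply: IHn; lia.
have aboveE w : v <= w <= v.+1 -> entry_above M u w = entry_above M' u w.
  case: u le_uv le_n {right_eq} => [|u] le_uv le_n vw //=; apply: IHn; lia.
have := SM u v le_uv ltv; rewrite (SM' u v le_uv ltv) right_eq !aboveE ?leqnn ?leqnSn //.
lia.
Qed.

Lemma jordan_type_unique M S S' :
  jordan_degree_type_of M S -> jordan_degree_type_of M S' -> S = S'.
Proof.
move=> [SM Ssupp] [SM' S'supp]; apply/msetP => x.
have [xS|xNS] := boolP (x \in S); last have [xS'|xNS'] := boolP (x \in S').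
- have [u [v [le_uv ltv xE]]] := Ssupp x xS; apply/eqP.
  by have := SM u v le_uv ltv; have := SM' u v le_uv ltv; rewrite xE; lia.
- have [u [v [le_uv ltv xE]]] := S'supp x xS'; apply/eqP.
  by have := SM u v le_uv ltv; have := SM' u v le_uv ltv; rewrite xE; lia.
by rewrite (mset_eq0P xNS) (mset_eq0P xNS').
Qed.

Definition multiplicity M u v : nat :=
  entry M u v + entry_above M u v.+1 - (entry_above M u v + entry M u v.+1).

Definition jordan_type M : {mset (nat * nat)} :=
  seq_mset (flatten [seq nseq (multiplicity M u v) (v - u + 1, u) |
                      u <- iota 0 N, v <- iota u (N - u)]).

Lemma count_jordan_type M x : jordan_type M x =
  \sum_(u <- iota 0 N) \sum_(v <- iota u (N - u))
    (x == (v - u + 1, u)) * multiplicity M u v.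
Proof.
rewrite /jordan_type mset_seqE count_flatten sumnE big_map big_flatten big_map.
apply: eq_bigr => u _; rewrite big_map; apply: eq_bigr => v _.
by rewrite count_nseq /= eq_sym mulnC.
Qed.
Lemma jordan_type_at M u v : u <= v < N ->
  jordan_type M (v - u + 1, u) = multiplicity M u v.
Proof.
case/andP=> le_uv ltv; rewrite count_jordan_type.
rewrite (bigD1_seq u) ?iota_uniq ?mem_iota /=; [|lia|by []].
rewrite (bigD1_seq v) ?iota_uniq ?mem_iota /=; [|lia|by []].
rewrite eqxx mul1n [X in _ + X + _]big1_seq ?big1 ?addn0 // => [u' Nu|v'].
  rewrite big1 // => v' _; rewrite xpair_eqE.
  have /negPf -> : u != u' by rewrite eq_sym.
  by rewrite andbF.
rewrite mem_iota xpair_eqE => /andP[Nv v'in].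
by have /negPf -> : v - u + 1 != v' - u + 1 by apply: contra Nv => /eqP; lia.
Qed.

End JordanType.

(** Non-negativity of the multiplicities is (iv) inside the matrix, and
    monotonicity of rows and columns on its first row and last column. *)
Lemma jordan_typeP (K : fieldType) (T : seq nat) (M : 'M[nat]_(size T)) :
  potential_rank_matrix K M -> jordan_degree_type_of M (jordan_type M).
Proof.
move=> prm; split=> [u v le_uv ltv|x].
  rewrite jordan_type_at ?le_uv // /multiplicity.
  suff : entry_above M u v + entry M u v.+1 <= entry M u v + entry_above M u v.+1 by lia.
  have [lt_vN|le_Nv] := ltnP v.+1 (size T); last first.
    rewrite entry_out ?addn0; last by rewrite leq_max le_Nv orbT.
    apply: leq_trans (leq_addr _ _); case: u le_uv => //= u lt_uv.
    exact: (prm_cols prm).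
  case: u le_uv => [|u] lt_uv /=; first by rewrite add0n addn0; apply: (prm_rows prm).
  have : v < (size T).-1 by lia.
  by move/(prm_exchange prm lt_uv).
rewrite -mset_neq0 count_jordan_type => /eqP sum0.
have /hasP[u uin] :
    has (fun u => has (fun v => x == (v - u + 1, u)) (iota u (size T - u)))
      (iota 0 (size T)).
  apply: contra_notT sum0 => /hasPn no; rewrite big1_seq // => u /= uin.
  rewrite big1_seq // => v /= vin.
  by have /hasPn/(_ v vin)/negPf -> := no u uin.
case/hasP=> v vin /eqP->; exists u, v; move: uin vin; rewrite !mem_iota; split=> //; lia.
Qed.

Lemma potential_matrices (K : fieldType) k (M : 'M[nat]_(size (hilb k))) : 4 <= k ->
  M \in [seq word_matrix (size (hilb k)) (start :: w) | w <- words (k + 3)] <->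
  potential_rank_matrix K M.
Proof.
move=> k4; split=> [/mapP[w win ->]|/(matrix_word_words k4)[w win ->]].
  exact: word_potential (words_realizable k4 win).
by apply/mapP; exists w.
Qed.



Theorem theorem3p6 (K : fieldType) (K_infinite : infinite_type K)
    (k : nat) (k_ge4 : 4 <= k) :
  let T := [:: 1; 3] ++ nseq k 5 ++ [:: 3; 1] in
  has_exactly 47 (fun S : {mset (nat * nat)} =>
                    potential_jordan_degree_type K T S) /\
  has_exactly 47 (fun M : 'M[nat]_(size T) => potential_rank_matrix K M).
Proof.
move=> T; pose Ms := [seq word_matrix (size T) (start :: w) | w <- words (k + 3)].
have memMs M : M \in Ms <-> potential_rank_matrix K M := potential_matrices K M k_ge4.
have [/eqP sizeW _] := words_count (leq_add k_ge4 (leqnn 3)).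
have sizeMs : size Ms = 47 by rewrite size_map.
have uniqMs : uniq Ms.
  by rewrite (map_inj_in_uniq (word_matrix_inj k_ge4)) words_uniq.
split; last by exists Ms.
exists [seq jordan_type M | M <- Ms]; split; rewrite ?size_map //.
  rewrite map_inj_in_uniq // => M M' /memMs prmM /memMs prmM' eqS.
  apply: (jordan_type_inj (prm_upper prmM) (prm_upper prmM') (jordan_typeP prmM)).
  by rewrite eqS; apply: jordan_typeP prmM'.
move=> S; split=> [/mapP[M /memMs prmM ->]|[M prmM SM]].
  by exists M => //; apply: jordan_typeP prmM.
apply/mapP; exists M; first exact/memMs.
exact: jordan_type_unique SM (jordan_typeP prmM).
Qed.
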